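(* Let $\kappa\in\mathbb{R}$ and let $X$ be a geodesic space. Assume that for any point $x\in X$ there is a neighborhood $\Omega\ni x$ in $X$ such that the (1+3)-point $\kappa$-comparison holds for any quadruple of points in $\Omega$. Then the completion $\bar X$ of $X$ is an Alexandrov space with curvature $\ge\kappa$.
   Context: $|xy|$ denotes the distance between points $x,y$ of a metric space. A geodesic space is a metric space in which any two points can be connected by a minimizing geodesic (a curve whose length equals the distance between its endpoints). $X$ is not assumed to be complete. A length space is a metric space in which any two points can be connected by a curve of length arbitrarily close to the distance between them. $\mathbb{M}^\kappa$ denotes the model $\kappa$-plane (the complete simply connected Riemannian surface of constant curvature $\kappa$), and $\varpi^\kappa=\operatorname{diam}\mathbb{M}^\kappa$, i.e. $\varpi^\kappa=\infty$ if $\kappa\le0$ and $\varpi^\kappa=\pi/\sqrt{\kappa}$ if $\kappa>0$. For points $p,x,y$ in a metric space, the model angle $\tilde\angle^\kappa(p;x,y)$ is the angle at $\tilde p$ of a triangle $[\tilde p\tilde x\tilde y]$ in $\mathbb{M}^\kappa$ with side lengths $|\tilde p\tilde x|=|px|$, $|\tilde p\tilde y|=|py|$, $|\tilde x\tilde y|=|xy|$. It is defined if $p\ne x$, $p\neq y$ and $|px|+|py|+|xy|<2\varpi^\kappa$. The (1+3)-point $\kappa$-comparison holds for a quadruple $(p;x^1,x^2,x^3)$ if $$\tilde\angle^\kappa(p;x^1,x^2)+\tilde\angle^\kappa(p;x^2,x^3)+\tilde\angle^\kappa(p;x^3,x^1)\le 2\pi$$ or at least one of the model angles $\tilde\angle^\kappa(p;x^i,x^j)$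 ($i\ne j$) is not defined. An Alexandrov space with curvature $\ge\kappa$ is a complete length space such that the (1+3)-point $\kappa$-comparison holds for every quadruple of its points. *)

(* Defs.v *)
From mathcomp Require Import all_boot all_order all_algebra.
From mathcomp Require Import all_classical all_reals all_analysis.

Set Implicit Arguments.
Unset Strict Implicit.
Unset Printing Implicit Defensive.

Import Order.TTheory GRing.Theory Num.Theory.
Import numFieldNormedType.Exports.

Local Open Scope classical_set_scope.
Local Open Scope ring_scope.

Section MetricNotions.
Context {R : realType}.

(* The metric analogue of [variation]: the length of the polygon inscribed in
   [g] with vertices at the parameters [a :: s]. *)
Definition polygon_length {X : metricType R} (a b : R) (g : R -> X)
    (s : seq R) : R :=
  \sum_(0 <= i < size s)
    mdist (g (nth b (a :: s) i)) (g (nth b (a :: s) i.+1)).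

Definition curve_length {X : metricType R} (a b : R) (g : R -> X) : \bar R :=
  ereal_sup [set (polygon_length a b g s)%:E | s in itv_partition a b].

(* Curves are parametrized by [0, 1]; values outside [0, 1] are irrelevant. *)
Definition curve_between {X : metricType R} (x y : X) (g : R -> X) : Prop :=
  [/\ {within `[0, 1], continuous g}, g 0 = x & g 1 = y].

Definition minimizing_geodesic {X : metricType R} (x y : X) (g : R -> X) :
    Prop :=
  curve_between x y g /\ curve_length 0 1 g = (mdist x y)%:E.

Definition geodesic_space (X : metricType R) : Prop :=
  forall x y : X, exists g, minimizing_geodesic x y g.

Definition length_space (X : metricType R) : Prop :=
  forall (x y : X) (e : R), 0 < e ->
    exists2 g, curve_between x y g &
      (curve_length 0 1 g < (mdist x y + e)%:E)%E.

(* [completeType] requires a base point, whereas an empty space is allowed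
   here; hence [exists l, F --> l] in place of [cvg F]. *)
Definition complete_space (X : metricType R) : Prop :=
  forall F : set_system X, ProperFilter F -> cauchy F -> exists l : X, F --> l.

(* [i] exhibits [Y] as the completion of [X], which is determined up to
   isometry. *)
Definition is_completion (X Y : metricType R) (i : X -> Y) : Prop :=
  [/\ forall x y, mdist (i x) (i y) = mdist x y,
      dense (range i) & complete_space Y].

End MetricNotions.

(* The model plane of curvature [k] is realized in R^3 as
   - the sphere of radius 1 / sqrt k in Euclidean space, if k > 0;
   - the Euclidean plane x_0 = 0, if k = 0;
   - the upper sheet of the hyperboloid <x, x> = 1 / k in Minkowski space with
     <x, y> = - x_0 y_0 + x_1 y_1 + x_2 y_2, if k < 0. *)
Section ModelPlane.
Context {R : realType} (k : R).
Implicit Types p x y : 'rV[R]_3.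

(* In the three cases Num.sg k is 1, 0 and -1. *)
Definition model_form x y : R :=
  Num.sg k * x 0 0 * y 0 0 + x 0 1 * y 0 1 + x 0 2 * y 0 2.

Definition model_plane : set 'rV[R]_3 :=
  [set x : 'rV[R]_3 | if k == 0 then x 0 0 = 0
           else k * model_form x x = 1 /\ (k < 0 -> 0 < x 0 0)].

Definition arcosh (c : R) : R := ln (c + Num.sqrt (c ^+ 2 - 1)).

(* The intrinsic (Riemannian) distance. *)
Definition model_dist x y : R :=
  if k == 0 then Num.sqrt (model_form (y - x) (y - x))
  else if 0 < k then acos (k * model_form x y) / Num.sqrt k
  else arcosh (k * model_form x y) / Num.sqrt (- k).

(* A tangent vector at [p] pointing in the direction of the geodesic from [p]
   to [x]; for k != 0 it is the orthogonal projection of [x] to the tangent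
   plane at [p], since <p, p> = 1 / k. *)
Definition model_dir p x : 'rV[R]_3 :=
  if k == 0 then x - p else x - (k * model_form p x) *: p.

(* The angle at [p] between the geodesics from [p] to [x] and to [y]. *)
Definition plane_angle p x y : R :=
  let u := model_dir p x in
  let v := model_dir p y in
  acos (model_form u v /
        (Num.sqrt (model_form u u) * Num.sqrt (model_form v v))).

Definition model_diam : \bar R :=
  if 0 < k then (pi / Num.sqrt k)%:E else +oo%E.

End ModelPlane.

Section Comparison.
Context {R : realType} (k : R) {X : metricType R}.
Implicit Types p x y : X.

Definition model_angle_defined p x y : Prop :=
  [/\ p != x, p != y &
      ((mdist p x + mdist p y + mdist x y)%:E < 2%:E * model_diam k)%E].

(* The triangle in the model plane exists and is unique up to isometry when
   the model angle is defined; otherwise the value is irrelevant. *)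
Definition model_angle p x y : R :=
  get [set t : R | exists p' x' y' : 'rV[R]_3,
    [/\ model_plane k p', model_plane k x' & model_plane k y'] /\
    [/\ model_dist k p' x' = mdist p x, model_dist k p' y' = mdist p y,
        model_dist k x' y' = mdist x y & t = plane_angle k p' x' y']].

Definition comparison13 p (x1 x2 x3 : X) : Prop :=
  model_angle p x1 x2 + model_angle p x2 x3 + model_angle p x3 x1 <= 2 * pi
  \/ ~ [/\ model_angle_defined p x1 x2, model_angle_defined p x2 x3 &
           model_angle_defined p x3 x1].

End Comparison.

Definition alexandrov_space {R : realType} (k : R) (X : metricType R) : Prop :=
  [/\ complete_space X, length_space X &
      forall p x1 x2 x3 : X, comparison13 k p x1 x2 x3].

(* Main.v *)
Require Import Defs.
From mathcomp Require Import all_boot all_order all_algebra.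
From mathcomp Require Import all_classical all_reals all_analysis.
From mathcomp Require Import ring lra.

Set Implicit Arguments.
Unset Strict Implicit.
Unset Printing Implicit Defensive.

Import Order.TTheory GRing.Theory Num.Theory.
Import numFieldNormedType.Exports.

Local Open Scope classical_set_scope.
Local Open Scope ring_scope.

(** Write [md] for the function with [md'' + k md = 1], [md 0 = md' 0 = 0]. Point-on-side
    comparison for [p] and a geodesic [c] says that [f = md |p c(t)|] satisfies
    [f'' + k f <= 1] in the sense of comparison with solutions. This is a local
    condition on [c], so it suffices to bound the second differences of [f] at each
    point [z] of [c]. Replace [p] by an interior point [p'] of a geodesic [z p], close
    to [p]. Since geodesics do not branch where the comparison holds, every point that
    almost realizes the distance from [z] to [p'] lies near the compact geodesic
    [z p'], where the local comparison holds at a uniform scale [a]; no completeness is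
    used. In that region the second-difference bound for [p'] is proved at the points
    at distance less than [m a] from [p'], by induction on [m], with the cat's cradle
    construction. The comparison of angles then passes to the completion by
    continuity. *)

(** * Trigonometry of the model planes *)

(** The obstacle is that almost shortest paths from [z] to [p] may leave every compact set, so the
    local radii met along them could shrink to 0. The piece of the geodesic between [p'] and [p]
    removes it: the comparison along this piece starts a chain that pins almost shortest paths from
    [p'] to the geodesic. The return to [p] costs one use of |p v| <= |p p'| + |p' v|, an equality
    at [v = z]. As a function of [md t], [md (t + d)] is concave, so the bound for [p'] passes to
    [p] with an error of order [sn d], where d = |p p'|. The slack [eta] in [semiconcave_at] absorbs
    it, since d can be taken small. The induction works because the cradle over a small pair [x],
    [y] around [w] asks for semiconcavity only at points further than [a] from [x]. Such points lie
    on paths hardly longer than |w p|, hence are nearer to [p] than [w] by almost [a]. *)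

Section ModelTrigonometry.
Context {R : realType} (k : R).
Implicit Types a b c s t x y : R.

(* [sn], [md] and [cs = sn'] solve [sn'' + k sn = 0] and [md' = sn]; working with
   [md] of a distance makes the law of cosines the same in all three signs of
   [k]. *)
Definition curv_rad : R := Num.sqrt `|k|.
Local Notation q := curv_rad.

Definition sn t : R :=
  if k == 0 then t else if 0 < k then sin (q * t) / q
  else (expR (q * t) - expR (- (q * t))) / (2 * q).

Definition md t : R :=
  if k == 0 then t ^+ 2 / 2 else if 0 < k then (1 - cos (q * t)) / k
  else (1 - (expR (q * t) + expR (- (q * t))) / 2) / k.

Definition cs t : R := 1 - k * md t.

(* The diameter bound [t < varpi^k] (vacuous for [k <= 0]). *)
Definition subdiam t : Prop := 0 < k -> q * t < pi.

Lemma curv_rad_sq_pos : 0 < k -> q ^+ 2 = k.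
Proof. by move=> k0; rewrite /q gtr0_norm// sqr_sqrtr// ltW. Qed.

Lemma curv_rad_sq_neg : k < 0 -> q ^+ 2 = - k.
Proof. by move=> k0; rewrite /q ltr0_norm// sqr_sqrtr// oppr_ge0 ltW. Qed.

Lemma curv_rad_gt0 : k != 0 -> 0 < q.
Proof. by move=> k0; rewrite sqrtr_gt0 normr_gt0. Qed.

Lemma md0 : md 0 = 0.
Proof.
rewrite /md; case: eqP => [_|/eqP k0]; first by rewrite expr0n/= mul0r.
case: ifP => _; rewrite mulr0 ?cos0 ?oppr0 ?expR0; first by rewrite subrr mul0r.
by rewrite (_ : (1 + 1) / 2 = 1 :> R) ?subrr ?mul0r//; field.
Qed.

Lemma sn0 : sn 0 = 0.
Proof.
rewrite /sn; case: eqP => [//|_].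
by case: ifP => _; rewrite mulr0 ?sin0 ?oppr0 ?expR0 ?subrr mul0r.
Qed.

Lemma cs0 : cs 0 = 1. Proof. by rewrite /cs md0 mulr0 subr0. Qed.

Lemma mdN t : md (- t) = md t.
Proof.
rewrite /md; case: eqP => [_|_]; first by rewrite sqrrN.
by case: ifP => _; rewrite mulrN ?cosN// opprK (addrC (expR (- _))).
Qed.

Lemma snN t : sn (- t) = - sn t.
Proof.
rewrite /sn; case: eqP => [//|_].
by case: ifP => _; rewrite mulrN ?sinN ?mulNr// opprK -opprB mulNr.
Qed.

Lemma csN t : cs (- t) = cs t. Proof. by rewrite /cs mdN. Qed.

Lemma mdD x y : md (x + y) = md x + md y - k * md x * md y + sn x * sn y.
Proof.
rewrite /md /sn; case: eqP => [->|/eqP k0]; first by field.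
case: ifPn => [kp|kp].
  have hq := curv_rad_sq_pos kp; have q0 := curv_rad_gt0 k0.
  rewrite mulrDr cosD -hq; field; lra.
have hq : q ^+ 2 = - k by apply: curv_rad_sq_neg; rewrite lt_neqAle k0 leNgt.
have q0 := curv_rad_gt0 k0.
have -> : k = - q ^+ 2 by rewrite hq opprK.
rewrite mulrDr opprD !expRD; field; lra.
Qed.

Lemma snD x y : sn (x + y) = sn x * cs y + cs x * sn y.
Proof.
rewrite /cs /md /sn; case: eqP => [->|/eqP k0]; first by field.
case: ifPn => [kp|kp].
  have q0 := curv_rad_gt0 k0.
  rewrite mulrDr sinD; field; by rewrite k0 andbT gt_eqF.
have q0 := curv_rad_gt0 k0.
rewrite mulrDr opprD !expRD; field; by rewrite k0 andbT gt_eqF.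
Qed.

Lemma csD x y : cs (x + y) = cs x * cs y - k * (sn x * sn y).
Proof. rewrite /cs mdD; ring. Qed.

Lemma sn_sq t : sn t ^+ 2 = md t * (1 + cs t).
Proof.
have := mdD t (- t); rewrite subrr md0 mdN snN /cs => h.
rewrite expr2; lra.
Qed.

Lemma md_ge0 t : 0 <= md t.
Proof.
rewrite /md; case: eqP => [_|/eqP k0]; first by rewrite mulr_ge0// ?sqr_ge0// invr_ge0.
case: ifPn => [kp|kp].
  by rewrite divr_ge0 ?subr_ge0 ?cos_le1// ltW.
have kn : k < 0 by rewrite lt_neqAle k0 leNgt.
have := expR_gt0 (q * t); set e := expR _ => e0.
rewrite expRN -/e -[_ / k]opprK -mulNr -mulrN -invrN divr_ge0 //; last lra.
have : 0 <= (e - 1) ^+ 2 / e by rewrite divr_ge0 ?sqr_ge0// ltW.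
have -> : (e - 1) ^+ 2 / e = e - 2 + e^-1 by field; lra.
lra.
Qed.

Lemma sn_gt0 t : 0 < t -> subdiam t -> 0 < sn t.
Proof.
move=> t0; rewrite /subdiam /sn; case: eqP => [//|/eqP k0].
have q0 := curv_rad_gt0 k0.
case: ifPn => [kp /(_ isT) tp|kp _].
  by rewrite divr_gt0// sin_gt0_pi// mulr_gt0.
rewrite divr_gt0 ?mulr_gt0// subr_gt0 ltr_expR.
have := mulr_gt0 q0 t0; lra.
Qed.

Lemma sn_ge0 t : 0 <= t -> subdiam t -> 0 <= sn t.
Proof.
by rewrite le_eqVlt => /orP[/eqP <- _|t0 tr]; rewrite ?sn0// ltW// sn_gt0.
Qed.

Lemma continuous_sn : continuous sn.
Proof.
move=> x; rewrite /sn; case: (k == 0); first exact: cvg_id.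
have cq : {for x, continuous (fun t => q * t)}.
  by apply: cvgM; [exact: cvg_cst|exact: cvg_id].
case: (0 < k).
  apply: cvgM; last exact: cvg_cst.
  by apply: (@continuous_comp _ _ _ _ (@sin R)) => //; exact: continuous_sin.
apply: cvgM; last exact: cvg_cst.
apply: cvgB.
  by apply: (@continuous_comp _ _ _ _ (@expR R)) => //; exact: continuous_expR.
apply: (@continuous_comp _ _ _ (fun t => - (q * t)) (@expR R)); last exact: continuous_expR.
exact: cvgN.
Qed.

Lemma continuous_md : continuous md.
Proof.
move=> x; rewrite /md; case: (k == 0).
  by apply: cvgM; [exact: exprn_continuous|exact: cvg_cst].
have cq : {for x, continuous (fun t => q * t)}.
  by apply: cvgM; [exact: cvg_cst|exact: cvg_id].
case: (0 < k); (apply: cvgM; last exact: cvg_cst);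
  (apply: cvgB; first exact: cvg_cst).
  by apply: (@continuous_comp _ _ _ _ (@cos R)) => //; exact: continuous_cos.
apply: cvgM; last exact: cvg_cst.
apply: cvgD.
  by apply: (@continuous_comp _ _ _ _ (@expR R)) => //; exact: continuous_expR.
apply: (@continuous_comp _ _ _ (fun t => - (q * t)) (@expR R)); last exact: continuous_expR.
exact: cvgN.
Qed.

Lemma le_subdiam s t : s <= t -> subdiam t -> subdiam s.
Proof.
move=> st tr kp; apply: le_lt_trans (tr kp).
by rewrite ler_wpM2l// sqrtr_ge0.
Qed.

(** Read off from [sn (2 t) = 2 sn t cs t]. *)
Lemma cs_gt0 t : 0 <= t -> subdiam (2 * t) -> 0 < cs t.
Proof.
rewrite le_eqVlt => /orP[/eqP <- _|t0 tr]; first by rewrite cs0.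
have st : 0 < sn t by apply: sn_gt0 => //; apply: le_subdiam tr; lra.
have : 0 < sn (2 * t) by apply: sn_gt0 => //; lra.
have -> : 2 * t = t + t by ring.
by rewrite snD [cs t * _]mulrC -mulr2n pmulrn_lgt0// pmulr_rgt0.
Qed.

Lemma mdB x y : md (x - y) = md x + md y - k * md x * md y - sn x * sn y.
Proof. by rewrite mdD mdN snN mulrN. Qed.

(** The difference is [2 sn ((t + s) / 2) sn ((t - s) / 2)]. The bound on [t] is not strict because
    [cos_angle_range] compares with arguments up to the diameter itself. *)
Lemma md_lt s t : 0 <= s -> s < t -> (0 < k -> q * t <= pi) -> md s < md t.
Proof.
move=> s0 st tr.
have -> : t = (t + s) / 2 + (t - s) / 2 by field.
have {1}-> : s = (t + s) / 2 - (t - s) / 2 by field.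
rewrite mdB mdD; set a := _ / 2; set b := (_ - _) / 2.
have aq u : 0 < u -> u < t -> 0 < sn u.
  move=> u0 ut; apply: sn_gt0 => // kp.
  apply: lt_le_trans (tr kp); rewrite ltr_pM2l//.
  by apply: curv_rad_gt0; rewrite gt_eqF.
have a0 : 0 < sn a by apply: aq; rewrite /a; lra.
have b0 : 0 < sn b.
  have [bt|bt] := ltP b t; first by apply: aq => //; rewrite /b; lra.
  by move: bt; rewrite /b; lra.
have := mulr_gt0 a0 b0; lra.
Qed.

Lemma md_le s t : 0 <= s -> s <= t -> (0 < k -> q * t <= pi) -> md s <= md t.
Proof.
move=> s0; rewrite le_eqVlt => /orP[/eqP ->//|st] tr.
by rewrite ltW// md_lt.
Qed.

Lemma subdiamW t : subdiam t -> (0 < k -> q * t <= pi).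
Proof. by move=> h kp; rewrite ltW// h. Qed.

Lemma md_le_subdiam s t : 0 <= s -> s <= t -> subdiam t -> md s <= md t.
Proof. by move=> s0 st /subdiamW; exact: md_le. Qed.

Lemma md_lt_inv s t : 0 <= t -> subdiam s -> md s < md t -> s < t.
Proof.
move=> t0 /subdiamW sr; rewrite !ltNge; apply: contra => ts.
exact: md_le.
Qed.

Lemma md_gt0 t : 0 < t -> subdiam t -> 0 < md t.
Proof. by move=> t0 /subdiamW tr; rewrite -md0 md_lt. Qed.

Lemma exists_subdiam : exists2 e : R, 0 < e & subdiam e.
Proof.
case: (ltP 0 k) => [kp|kn]; last by exists 1 => // kp; move: kn; rewrite leNgt kp.
have q0 : 0 < q by apply: curv_rad_gt0; rewrite gt_eqF.
exists (1 / q) => [|_]; first by rewrite divr_gt0.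
rewrite mulrCA divff ?gt_eqF// mulr1.
have := pi_ge2 R; lra.
Qed.

(* Concavity of [sn] as a function of [md], in the form [0 <= md (x - x0)]. *)
Lemma md_add_le x x0 d : 0 <= sn d -> 0 < sn x0 ->
  md (x + d) <= md (x0 + d) + sn (x0 + d) / sn x0 * (md x - md x0).
Proof.
move=> d0 x00.
have := md_ge0 (x - x0); rewrite mdB => h.
have hs := sn_sq x0.
rewrite -subr_ge0.
have -> : md (x0 + d) + sn (x0 + d) / sn x0 * (md x - md x0) - md (x + d) =
  sn d / sn x0 * (sn x0 ^+ 2 + cs x0 * (md x - md x0) - sn x * sn x0).
  by rewrite snD !mdD /cs; field; rewrite gt_eqF.
apply: mulr_ge0; first by rewrite divr_ge0// ltW.
by rewrite hs; move: h; rewrite /cs; lra.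
Qed.

End ModelTrigonometry.

(** * Maximum principle for h'' + k h = 1 *)

Section SineConcavity.
Context {R : realType} (k : R).
Local Notation sn := (sn k).
Local Notation cs := (cs k).
Local Notation md := (md k).
Local Notation subdiam := (subdiam k).
Implicit Types A v s t L : R.

(* The solution of [h'' + k h = 1] with [h 0 = A] and [h' 0 = v]. *)
Definition jacobi A v t : R := md t + cs t * A + sn t * v.

Lemma jacobi0 A v : jacobi A v 0 = A.
Proof. by rewrite /jacobi md0 cs0 sn0 mul0r mul1r add0r addr0. Qed.

Lemma jacobi_sym A v t s :
  jacobi A v (t + s) + jacobi A v (t - s) - 2 * jacobi A v t =
  2 * md s * (1 - k * jacobi A v t).
Proof.
rewrite /jacobi !(mdD, snD, csD) !(mdN, snN, csN) /cs; ring.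
Qed.

Lemma jacobi_continuous A v : continuous (jacobi A v).
Proof.
move=> x; apply: cvgD; first apply: cvgD.
- exact: continuous_md.
- apply: cvgM; last exact: cvg_cst.
  apply: cvgB; first exact: cvg_cst.
  by apply: cvgM; [exact: cvg_cst|exact: continuous_md].
- by apply: cvgM; [exact: continuous_sn|exact: cvg_cst].
Qed.

Lemma cs_ge_min t s : 0 <= s -> s <= t -> subdiam t -> cs s >= Num.min 1 (cs t).
Proof.
move=> s0 st tr; rewrite ge_min /cs; case: (lerP k 0) => k0.
  have : k * md s <= 0 by rewrite mulr_le0_ge0 ?md_ge0.
  by move=> h; apply/orP; left; lra.
have : k * md s <= k * md t by rewrite ler_wpM2l ?(ltW k0)// md_le_subdiam.
by move=> h; apply/orP; right; lra.
Qed.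

(* Finite-difference form of [w'' + k w = -1]. *)
Lemma exists_barrier L : 0 < L -> subdiam L ->
  exists2 w : R -> R, continuous w &
   (forall t, 0 <= t <= L -> 0 < w t) /\
   (forall t s, w (t + s) + w (t - s) - 2 * w t = - (2 * md s * (1 + k * w t))).
Proof.
move=> L0 Lr; set c := cs (L / 2).
have L2r : subdiam (L / 2) by apply: le_subdiam Lr; lra.
have c0 : 0 < c by apply: cs_gt0; [lra|rewrite mulrC divfK].
(* The barrier is [B cs u - md u] with [u = t - L / 2]. Centering at the midpoint keeps [cs]
   positive, whereas [cs L] may be negative when [k > 0]. On the interval [cs u >= min 1 c], so
   [(1 + c^-1) cs u >= 1], and this size of [B] gives positivity. *)
pose B := (md (L / 2) + 1) * (1 + c^-1).
have m0 : 0 < md (L / 2) + 1 by have := md_ge0 k (L / 2); lra.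
exists (fun t => - jacobi (- B) 0 (t - L / 2)).
  move=> x.
  apply: cvgN; apply: (@continuous_comp _ _ _ (fun t => t - L / 2)).
    by apply: cvgB; [exact: cvg_id|exact: cvg_cst].
  exact: jacobi_continuous.
split=> [t /andP[t0 tL]|t s].
  rewrite /jacobi mulr0 addr0 opprD mulrN opprK.
  pose u := `|t - L / 2|.
  have u0 : 0 <= u by exact: normr_ge0.
  have uL : u <= L / 2 by rewrite ler_norml; apply/andP; split; lra.
  have mdu : md (t - L / 2) = md u.
    by rewrite /u; case: (ler0P (t - L / 2)) => _; rewrite ?mdN.
  have -> : cs (t - L / 2) = cs u by rewrite /cs mdu.
  rewrite mdu.
  have mu : md u <= md (L / 2) by exact: md_le_subdiam.
  have cu : 1 <= (1 + c^-1) * cs u.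
    have := cs_ge_min u0 uL L2r; rewrite ge_min -/c => /orP[h|h].
      rewrite mulrDl mul1r; have : 0 <= c^-1 * cs u by
        rewrite mulr_ge0 ?invr_ge0 ?(ltW c0)//; lra.
      lra.
    have : c^-1 * c <= c^-1 * cs u by rewrite ler_pM2l ?invr_gt0.
    by rewrite mulVf ?gt_eqF// mulrDl mul1r; lra.
  have : (md (L / 2) + 1) * 1 <= cs u * B.
    by rewrite [cs u * B]mulrC /B -mulrA ler_pM2l.
  lra.
have := jacobi_sym (- B) 0 (t - L / 2) s.
have -> : t + s - L / 2 = t - L / 2 + s by ring.
have -> : t - s - L / 2 = t - L / 2 - s by ring.
move=> h; lra.
Qed.

(** Suppose [phi - jacobi] divided by the barrier [w] has a negative minimum [- lam] at [t0]. Then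
    [phi - jacobi + lam w] is nonnegative and vanishes at [t0], so its second differences there are
    nonnegative. The equation of [w] and the hypothesis with [eta = lam / 2] then give
    [lam <= lam / 2]. *)
Lemma jacobi_le (phi : R -> R) L A v : 0 < L -> subdiam L -> continuous phi ->
  (forall t, 0 < t < L -> forall eta e, 0 < eta -> 0 < e ->
    exists s, [/\ 0 < s, s < e &
      phi (t + s) + phi (t - s) - 2 * phi t <=
      2 * md s * (1 - k * phi t + eta)]) ->
  A <= phi 0 -> jacobi A v L <= phi L ->
  forall t, 0 <= t <= L -> jacobi A v t <= phi t.
Proof.
move=> L0 Lr cphi H h0 hL t1 t1L; rewrite leNgt; apply/negP => neg.
have [w cw [w0 wd]] := exists_barrier L0 Lr.
pose g t := phi t - jacobi A v t.
pose f t := g t / w t.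
have cf : {within `[0, L], continuous f}.
  apply: continuous_in_subspaceT => x /set_mem/=; rewrite in_itv/= => xL.
  apply: cvgM; first by apply: cvgB; [exact: cphi|exact: jacobi_continuous].
  by apply: cvgV; [rewrite gt_eqF// w0|exact: cw].
have [t0 t0L min] := EVT_min (ltW L0) cf.
move: t0L; rewrite in_itv/= => t0L.
have f1 : f t1 < 0 by rewrite /f pmulr_llt0 ?invr_gt0 ?w0// subr_lt0.
have ft0 : f t0 < 0 by apply: le_lt_trans f1; apply: min; rewrite in_itv.
have gw t : 0 <= t <= L -> g t = f t * w t.
  by move=> tL; rewrite /f divfK// gt_eqF// w0.
have gt0 : g t0 < 0 by rewrite gw// pmulr_llt0// w0.
have ti : 0 < t0 < L.
  case/andP: t0L; rewrite !le_eqVlt => /orP[/eqP t00|->].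
    by move: gt0; rewrite -t00 /g jacobi0; lra.
  by case/orP => [/eqP tL|-> //]; move: gt0; rewrite tL /g; lra.
pose lam := - f t0.
have lam0 : 0 < lam by rewrite oppr_gt0.
have [e1 e10 e1r] := exists_subdiam k.
have lam20 : 0 < lam / 2 by rewrite divr_gt0.
have em : 0 < Num.min e1 (Num.min t0 (L - t0)) by rewrite !lt_min e10/= subr_gt0.
have [s [s0 se]] := H t0 ti _ _ lam20 em.
move: se; rewrite !lt_min => /and3P[se1 st0 sL] ineq.
have ms : 0 < md s by apply: md_gt0 => //; apply: le_subdiam e1r; exact: ltW.
case/andP: ti => t00 t0L'.
have gmin t : 0 <= t <= L -> - lam * w t <= g t.
  by move=> tL; rewrite gw// ler_wpM2r ?(ltW (w0 _ tL))// /lam opprK min ?in_itv.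
have gp : - lam * w (t0 + s) <= g (t0 + s) 
  by apply: gmin; apply/andP; move: st0 sL s0 t00 t0L'; clear -k; split; lra.
have gm : - lam * w (t0 - s) <= g (t0 - s) 
  by apply: gmin; apply/andP; move: st0 sL s0 t00 t0L'; clear -k; split; lra.
have g0 : g t0 = - lam * w t0 by rewrite gw// /lam opprK.
have ha := jacobi_sym A v t0 s.
have hw := wd t0 s.
have hs : g (t0 + s) + g (t0 - s) - 2 * g t0 <= 2 * md s * (- k * g t0 + lam / 2).
  by move: ha ineq; rewrite /g; clear -k; lra.
have key : lam * (2 * md s * (1 + k * w t0)) <= 2 * md s * (k * lam * w t0 + lam / 2).
  apply: le_trans (_ : _ <= g (t0 + s) + g (t0 - s) - 2 * g t0) _.
    rewrite g0; apply: le_trans (_ : - lam * (w (t0 + s) + w (t0 - s) - 2 * w t0) <= _).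
      by rewrite hw mulrNN.
    by move: gp gm; clear -k; lra.
  by apply: le_trans hs _; rewrite g0; clear -k; lra.
have : 0 < lam * md s by rewrite mulr_gt0.
move: key; clear -k; lra.
Qed.

End SineConcavity.

(** * Geodesics and point-on-side comparison *)

Section Geodesics.
Context {R : realType} {X : metricType R}.
Implicit Types (x y p v : X) (c : R -> X) (L s t : R).

Lemma mdist_lipschitz p x y : `|mdist p x - mdist p y| <= mdist x y.
Proof.
rewrite ler_norml; apply/andP; split.
  by have := metric_triangle p x y; lra.
by have := metric_triangle p y x; rewrite (metric_sym y x); lra.
Qed.

Lemma mdist_continuous p : continuous (mdist p : X -> R).
Proof.
move=> x; apply/(@cvgrPdist_lt R R^o) => e e0.
apply: filterS (nbhsx_ballx x e e0) => y.
by rewrite ballEmdist/=; apply: le_lt_trans; exact: mdist_lipschitz.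
Qed.

Definition is_geo c L : Prop :=
  forall s t, 0 <= s <= L -> 0 <= t <= L -> mdist (c s) (c t) = `|s - t|.

Section CurveToGeodesic.
Variables (x y : X) (g : R -> X).
Hypothesis hg : minimizing_geodesic x y g.

Lemma minimizing_polygon (s : seq R) :
  itv_partition 0 1 s -> polygon_length 0 1 g s <= mdist x y.
Proof.
move=> sp; rewrite -lee_fin -hg.2; apply: ereal_sup_ubound.
by exists s.
Qed.

(** This is the inscribed polygon with parameters 0, s, t, 1. Partitions are strictly increasing, so
    coinciding parameters are treated apart. *)
Lemma minimizing_split s t : 0 <= s -> s <= t -> t <= 1 ->
  mdist x (g s) + mdist (g s) (g t) + mdist (g t) y <= mdist x y.
Proof.
have [[_ g0 g1] _] := hg.
have two t' : 0 <= t' <= 1 -> mdist x (g t') + mdist (g t') y <= mdist x y.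
  case/andP; rewrite le_eqVlt => /orP[/eqP <- _|t0].
    by rewrite g0 mdistxx add0r.
  rewrite le_eqVlt => /orP[/eqP ->|t1]; first by rewrite g1 mdistxx addr0.
  have := @minimizing_polygon [:: t'; 1].
  rewrite /polygon_length /= big_nat_recl//= big_nat1/= g0 g1; apply.
  by split; rewrite //= t0 t1.
move=> s0 st t1.
have tI : 0 <= t <= 1 by rewrite t1 (le_trans s0 st).
case: (eqVneq s t) => [->|st']; first by rewrite mdistxx addr0 two.
move: s0; rewrite le_eqVlt => /orP[/eqP <-|s0].
  by rewrite g0 mdistxx add0r two.
move: (t1); rewrite le_eqVlt => /orP[/eqP t1E|t1'].
  by rewrite t1E g1 mdistxx addr0 two// ltW//= -t1E.
have := @minimizing_polygon [:: s; t; 1].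
rewrite /polygon_length /= big_nat_recl//= big_nat_recl//= big_nat1/= g0 g1 addrA.
apply; split; rewrite //= s0 t1' lt_neqAle st' st//.
Qed.

(** Reparametrization by the distance from [x]: the intermediate value theorem picks a parameter
    [T d] for each distance [d], and [minimizing_split] makes the distances along the curve
    additive. *)
Lemma geodesic_of_curve :
  exists c, [/\ c 0 = x, c (mdist x y) = y & is_geo c (mdist x y)].
Proof.
have [[cg g0 g1] _] := hg; set D := mdist x y.
have D0 : 0 <= D by exact: mdist_ge0.
have cd : {within `[0, 1], continuous (mdist x \o g)}.
  by move=> t; exact: (cvg_comp _ _ (cg t) (@mdist_continuous x (g t))).
have /choice[T HT] : forall d, exists t, 0 <= d <= D ->
    0 <= t <= 1 /\ mdist x (g t) = d.
  move=> d; case: (boolP (0 <= d <= D)) => [dD|_]; last by exists 0.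
  have [|t tI td] := @IVT R (mdist x \o g) 0 1 d ler01 cd.
    by rewrite /= g0 g1 mdistxx -/D min_l// max_r.
  by exists t; move: tI; rewrite in_itv.
have main s t : 0 <= s <= D -> 0 <= t <= D -> T s <= T t ->
    mdist (g (T s)) (g (T t)) = `|s - t|.
  move=> /HT[/andP[s0 s1] sd] /HT[/andP[t0 t1] td] st.
  have := minimizing_split s0 st t1; rewrite sd => h.
  have h1 := metric_triangle x (g (T t)) y; rewrite td in h1.
  have := mdist_lipschitz x (g (T s)) (g (T t)); rewrite sd td => h2.
  apply/eqP; rewrite eq_le h2 andbT.
  have h3 := metric_triangle x (g (T s)) (g (T t)); rewrite sd td in h3.
  by rewrite distrC; apply: le_trans (ler_norm _); lra.
have HG : is_geo (g \o T) D.
  move=> s t sD tD; case: (leP (T s) (T t)) => h /=; first exact: main.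
  by rewrite metric_sym distrC; apply: main => //; exact: ltW.
have z0 : 0 <= (0 : R) <= D by rewrite lexx.
have zD : 0 <= D <= D by rewrite D0 lexx.
exists (g \o T); split => //=.
  by apply/esym/mdist_positivity; have [] := HT _ z0.
have [/andP[t0 t1] td] := HT _ zD.
have := minimizing_split (lexx 0) t0 t1.
rewrite g0 mdistxx add0r td => h.
apply: mdist_positivity; apply/eqP; rewrite eq_le mdist_ge0 andbT.
by move: h; rewrite -/D; lra.
Qed.

End CurveToGeodesic.

Hypothesis geoX : geodesic_space X.

Lemma exists_geo x y :
  exists c, [/\ c 0 = x, c (mdist x y) = y & is_geo c (mdist x y)].
Proof. by have [g /geodesic_of_curve] := geoX x y. Qed.

Lemma exists_point_at x y t : 0 <= t <= mdist x y ->
  exists v, mdist x v = t /\ mdist v y = mdist x y - t.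
Proof.
move=> tD; have [c [c0 c1 cg]] := exists_geo x y.
have z0 : 0 <= (0 : R) <= mdist x y by rewrite lexx mdist_ge0.
have zD : 0 <= mdist x y <= mdist x y by rewrite mdist_ge0 lexx.
exists (c t); split.
  by rewrite -c0 cg// sub0r normrN ger0_norm//; case/andP: tD.
by rewrite -{1}c1 cg// distrC ger0_norm// subr_ge0; case/andP: tD.
Qed.

(** Composing with this retraction extends a geodesic on [0, L] to a 1-Lipschitz map on the line, so
    that continuity and Lipschitz bounds can be stated globally. *)
Definition clamp L t : R := Num.max 0 (Num.min L t).

Lemma clamp_id L t : 0 <= t <= L -> clamp L t = t.
Proof. by case/andP=> t0 tL; rewrite /clamp min_r// max_r. Qed.

Lemma clamp_itv L t : 0 <= L -> 0 <= clamp L t <= L.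
Proof. by move=> L0; rewrite /clamp le_max lexx/= ge_max L0 ge_min lexx. Qed.

Lemma clamp_lipschitz L s t : 0 <= L -> `|clamp L s - clamp L t| <= `|s - t|.
Proof.
move=> L0; have h1 := ler_norm (s - t); have h2 := ler_norm (t - s).
rewrite distrC in h2; rewrite ler_norml /clamp.
by case: (leP L s) => ?; case: (leP L t) => ?; rewrite ?(max_r L0);
  try case: (leP 0 s) => ?; try case: (leP 0 t) => ?; apply/andP; split; lra.
Qed.

Lemma geo_dist_continuous p c L : 0 <= L -> is_geo c L ->
  continuous (fun t => mdist p (c (clamp L t))).
Proof.
move=> L0 cg t; apply/(@cvgrPdist_lt R R^o) => e e0.
near=> u; apply: le_lt_trans (mdist_lipschitz _ _ _) _.
rewrite cg ?clamp_itv//; apply: le_lt_trans (clamp_lipschitz _ _ L0) _.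
by near: u; exact: (@cvgr_dist_lt R R^o).
Unshelve. all: by end_near. Qed.

End Geodesics.

(** * The three-point inequality and second differences of [md] of the distance *)

Section ThreePoint.
Context {R : realType} (k : R) {X : metricType R}.
Local Notation sn := (sn k).
Local Notation cs := (cs k).
Local Notation md := (md k).
Local Notation subdiam := (subdiam k).
Local Notation jacobi := (jacobi k).
Implicit Types (p x y u v w : X) (A B C L s t a b e q z : R).

(** The flow property of the equation: [sn t * (1 - k * A) + cs t * z] is the derivative of the
    solution at [t]. *)
Lemma jacobi_shift A z t s :
  jacobi A z (t + s) = jacobi (jacobi A z t) (sn t * (1 - k * A) + cs t * z) s.
Proof. rewrite /jacobi !(mdD, snD, csD) /cs; ring. Qed.

Lemma sn_md_cross s t :
  sn t * md s + sn s * md t = sn s * md (s + t) - sn (s + t) * md s.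
Proof.
have := sn_sq k s; rewrite snD mdD /cs => h.
have -> : sn s * (md s + md t - k * md s * md t + sn s * sn t) =
  sn s * (md s + md t - k * md s * md t) + sn s ^+ 2 * sn t by ring.
rewrite h; ring.
Qed.

(** Initial slope of the solution of h'' + k h = 1 with values [A] at 0 and [B] at [L]. For
    distances it is minus the sine of a side times the cosine of a model angle. *)
Definition chord_slope A B L : R := (B - md L - cs L * A) / sn L.

Lemma jacobi_chord A B L : sn L != 0 -> jacobi A (chord_slope A B L) L = B.
Proof. by move=> L0; rewrite /jacobi /chord_slope; field. Qed.

Lemma three_point_chord A B C s t : 0 < sn (s + t) ->
  sn t * A + sn s * B <= sn (s + t) * C + sn t * md s + sn s * md t ->
  jacobi A (chord_slope A B (s + t)) s <= C.
Proof.
move=> st0; rewrite -addrA sn_md_cross => h.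
rewrite -(ler_pM2l st0) /jacobi /chord_slope.
have -> : sn (s + t) * (md s + cs s * A + sn s * ((B - md (s + t) -
  cs (s + t) * A) / sn (s + t))) = sn (s + t) * md s + sn s * (B - md (s + t))
  + (sn (s + t) * cs s - sn s * cs (s + t)) * A by field; rewrite gt_eqF.
have -> : sn (s + t) * cs s - sn s * cs (s + t) = sn t.
  have := snD k (s + t) (- s).
  by rewrite addrAC subrr add0r snN csN => ->; ring.
lra.
Qed.

(** The same inequality as in [three_point_chord], read outwards: a lower bound at one end with
    slope [- z] at the middle forces an upper bound with slope [z] at the other end. *)
Lemma three_point_extend A B C s t z : 0 < sn s -> 0 <= sn t ->
  sn t * A + sn s * B <= sn (s + t) * C + sn t * md s + sn s * md t ->
  jacobi C (- z) s <= A -> B <= jacobi C z t.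
Proof.
move=> s0 t0 h hA; rewrite -(ler_pM2l s0).
have := ler_wpM2l t0 hA.
move: h; rewrite snD /jacobi; lra.
Qed.

(** Divide by [sn t] and let [t] tend to 0: where [cs t > 0], [sn_sq] gives [md t <= sn t ^+ 2], so
    the right side is of second order. It serves to compare slopes of two bounds that agree at an
    end. *)
Lemma le0_of_infinitesimal a C e : 0 < e ->
  (forall t, 0 < t <= e -> sn t * a <= C * md t) -> a <= 0.
Proof.
move=> e0 H; rewrite leNgt; apply/negP => a0.
have [e1 e10 e1r] := exists_subdiam k.
have aC : 0 < a / (`|C| + 1) by rewrite divr_gt0// ltr_pwDr.
have := @cvgr_dist_lt R R^o _ _ _ sn (sn 0) (@continuous_sn R k 0) _ aC.
rewrite sn0 => -[d /= d0 hd].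
pose m := Num.min d (Num.min e e1).
have m0 : 0 < m by rewrite !lt_min d0 e0.
have := lexx m; rewrite {2}/m !le_min => /and3P[md1 me me1].
pose t := m / 2.
have t0 : 0 < t by rewrite divr_gt0.
have tm : t < m by rewrite /t; lra.
have st : 0 < sn t by apply: sn_gt0 => //; apply: le_subdiam e1r; lra.
have ct : 0 < cs t by apply: cs_gt0; [lra|apply: le_subdiam e1r; rewrite /t; lra].
have : sn t < a / (`|C| + 1).
  have : ball 0 d t by rewrite /ball/= sub0r normrN gtr0_norm//; lra.
  by move=> /hd /=; rewrite sub0r normrN gtr0_norm.
rewrite ltr_pdivlMr; last by rewrite ltr_pwDr.
have C0 := normr_ge0 C.
have := H t; rewrite t0/= => /(_ (ltW (lt_le_trans tm me))) h.
have ms : md t <= sn t ^+ 2.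
  by rewrite sn_sq mulrDr mulr1 lerDl mulr_ge0 ?md_ge0// ltW.
have h2 : C * md t <= `|C| * sn t ^+ 2.
  apply: le_trans (_ : `|C| * md t <= _); last by rewrite ler_wpM2l.
  by rewrite ler_wpM2r ?md_ge0// ler_norm.
have : sn t * a <= sn t * (`|C| * sn t).
  by rewrite mulrCA -expr2; apply: le_trans h h2.
rewrite ler_pM2l// => h3 h4.
have : sn t * (`|C| + 1) = `|C| * sn t + sn t by ring.
lra.
Qed.

(* Point-on-side comparison for the triangle [p x y] and [v] on the side [xy],
   written linearly in the values of [md \o mdist p]. *)
Definition three_point p x v y : Prop :=
  sn (mdist v y) * md (mdist p x) + sn (mdist x v) * md (mdist p y) <=
  sn (mdist x v + mdist v y) * md (mdist p v) +
  sn (mdist v y) * md (mdist x v) + sn (mdist x v) * md (mdist v y).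

Definition locally_three_point w (r : R) : Prop :=
  forall p x v y, mdist w p < r -> mdist w x < r -> mdist w v < r ->
    mdist w y < r -> mdist x v + mdist v y = mdist x y -> three_point p x v y.

(* Finite-difference form of [f'' <= 1 - k f] at [w] along every geodesic through
   [w], for [f = md \o mdist p]. *)
Definition semiconcave_at p w : Prop :=
  forall eta, 0 < eta -> exists2 e : R, 0 < e &
    forall s x y, 0 < s < e -> mdist w x = s -> mdist w y = s ->
      mdist x y = 2 * s ->
      md (mdist p x) + md (mdist p y) - 2 * md (mdist p w) <=
      2 * md s * (1 - k * md (mdist p w) + eta).

(** Three-point inequality at the midpoint [w], divided by [sn s] after [sn (2 s) = 2 sn s cs s]. *)
Lemma locally_three_point_semiconcave p w r : 0 < r -> mdist w p < r ->
  locally_three_point w r -> semiconcave_at p w.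
Proof.
move=> r0 pr H eta eta0; have [e1 e10 e1r] := exists_subdiam k.
exists (Num.min r e1); first by rewrite lt_min r0.
move=> s x y /andP[s0]; rewrite lt_min => /andP[sr se] wx wy xy.
have := H p x w y pr; rewrite mdistxx wx wy (metric_sym x) wx xy.
move=> /(_ sr r0 sr); rewrite mulr2n mulrDl mul1r => /(_ erefl).
have ss : 0 < sn s by apply: sn_gt0 => //; apply: le_subdiam e1r; exact: ltW.
rewrite /three_point wy (metric_sym x) wx snD => h.
have {h} : sn s * (md (mdist p x) + md (mdist p y)) <=
  sn s * (2 * cs s * md (mdist p w) + 2 * md s) by lra.
rewrite ler_pM2l// => h.
have : 0 <= md s * eta by rewrite mulr_ge0 ?md_ge0// ltW.
move: h; rewrite /cs; lra.
Qed.

Lemma jacobi_le_geo p (c : R -> X) L A z : 0 < L -> subdiam L -> is_geo c L ->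
  (forall t, 0 < t < L -> semiconcave_at p (c t)) ->
  A <= md (mdist p (c 0)) -> jacobi A z L <= md (mdist p (c L)) ->
  forall t, 0 <= t <= L -> jacobi A z t <= md (mdist p (c t)).
Proof.
move=> L0 Lr cg H hA hv t tL.
have l0 := ltW L0.
pose phi (u : R) := md (mdist p (c (clamp L u))).
have phiE (u : R) : 0 <= u <= L -> phi u = md (mdist p (c u)).
  by move=> uL; rewrite /phi clamp_id.
have zL : 0 <= (0 : R) <= L by rewrite lexx.
have LL : 0 <= L <= L by rewrite l0 lexx.
rewrite -phiE//; apply: (@jacobi_le _ k phi L A z) => //; last 2 first.
- by rewrite phiE.
- by rewrite phiE.
- move=> u; apply: (@continuous_comp _ _ _ (fun u : R => mdist p (c (clamp L u))) md).
    exact: geo_dist_continuous.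
  exact: continuous_md.
move=> u /[dup] uL /andP[u0 u1] eta e eta0 e0.
have [e' e'0 He] := H u uL eta eta0.
pose m := Num.min (Num.min e e') (Num.min u (L - u)).
have m0 : 0 < m by rewrite !lt_min e0 e'0 u0 subr_gt0.
have := lexx m; rewrite {2}/m !le_min => /andP[/andP[me me'] /andP[mu mL]].
have uI : 0 <= u <= L by apply/andP; split; lra.
have upI : 0 <= u + m / 2 <= L by apply/andP; split; lra.
have umI : 0 <= u - m / 2 <= L by apply/andP; split; lra.
exists (m / 2); split; [lra|lra|].
rewrite !phiE//; apply: He.
- by apply/andP; split; lra.
- by rewrite cg// opprD addNKr normrN gtr0_norm//; lra.
- by rewrite cg// opprB addrC subrK gtr0_norm//; lra.
- rewrite cg// (_ : _ - _ = m); last by field.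
  by rewrite gtr0_norm//; field.
Qed.

End ThreePoint.

(** * The cat's cradle *)

Section Cradle.
Context {R : realType} (k : R) {X : metricType R}.
Local Notation sn := (sn k).
Local Notation cs := (cs k).
Local Notation md := (md k).
Local Notation subdiam := (subdiam k).
Local Notation jacobi := (jacobi k).
Hypothesis geoX : geodesic_space X.
Implicit Types (p x y u v w : X) (A B C L s t a b e q z : R).

(* [md] of the third side of the model hinge with sides [y x] and [y p], whose
   angle is the model angle at [y] of the triangle [y x u], [u] on [y p]. *)
Definition hinge_md p x y u : R :=
  md (mdist y x) + cs (mdist y x) * md (mdist p y) +
  sn (mdist p y) / sn (mdist y u) *
    (md (mdist x u) - md (mdist y x) - cs (mdist y x) * md (mdist y u)).

(** In the model triangle [y x u], prolong the side y u beyond u by [t]. The distance from x to the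
    new endpoint is computed on the right by the hinge at y, on the left by the hinge at u with the
    supplementary angle. *)
Lemma hinge_md_other_side c t q d b : c + t = b -> sn c != 0 -> sn d != 0 ->
  jacobi (md t) (- sn t * chord_slope k (md c) (md q) d / sn c) d =
  md q + cs q * md b + sn b / sn c * (md d - md q - cs q * md c).
Proof.
move=> <- c0 d0; have := sn_sq k c; rewrite /jacobi /chord_slope snD mdD => h.
have -> : cs q * (md c + md t - k * md c * md t + sn c * sn t) =
  cs q * (md c + md t - k * md c * md t + sn c ^+ 2 / sn c * sn t) by field.
by rewrite h /cs; field; rewrite c0.
Qed.

(* The path from [w] to [p] is taken through [v], a point of [u p]. *)
Lemma dist_past_corner p x y u v w a q c d b t :
  mdist y x = q -> mdist y u = c -> mdist u x = d -> mdist p u = b ->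
  mdist u w = t -> mdist w x = d - t ->
  mdist u v = a -> mdist p v = b - a -> mdist y v = c + a ->
  three_point k y u w x -> three_point k w y u v ->
  0 < sn a -> 0 < sn c -> 0 < sn d -> 0 < sn b -> 0 <= sn (b - a) ->
  subdiam (t + b) ->
  md (mdist p w) <= md b + sn b / sn a * cs a * md t +
    sn t * (- sn b * chord_slope k (md c) (md q) d / sn c).
Proof.
move=> yx yu ux pu uw wx uv pv yv T1 T2 sa sc sd sb sba diam.
have h1 : jacobi (md c) (chord_slope k (md c) (md q) d) t <= md (mdist y w).
  have dE : d = t + (d - t) by rewrite addrC subrK.
  rewrite [in chord_slope _ _ _ d]dE.
  apply: three_point_chord; first by rewrite -dE.
  by move: T1; rewrite /three_point yu yx uw wx.
(* With this slope the solution along [u y] seen from [w] and the one along [u x] seen from [y] take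
   the same value: both are the law of cosines at [u] with sides [t] and [c]. *)
pose z2 := - (sn t * chord_slope k (md c) (md q) d / sn c).
have h2 : md (mdist w v) <= jacobi (md t) z2 a.
  apply: (@three_point_extend _ k (md (mdist w y)) _ (md t) c) => //.
  - exact: ltW.
  - by move: T2; rewrite /three_point yu uv (metric_sym w u) uw.
  rewrite metric_sym; apply: le_trans h1; rewrite le_eqVlt; apply/orP; left.
  by apply/eqP; rewrite /jacobi /z2 opprK /cs; field; rewrite gt_eqF.
have h3 : md (mdist p w) <= md (mdist w v + (b - a)).
  apply: md_le_subdiam; first exact: mdist_ge0.
    by have := metric_triangle p v w; rewrite pv (metric_sym v) addrC.
  have := metric_triangle w u v; rewrite uv (metric_sym w u) uw.
  by move=> h; apply: le_subdiam diam; clear -k geoX h; lra.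
have h4 := @md_add_le _ k (mdist w v) a (b - a) sba sa.
rewrite [a + _]addrC subrK in h4.
have h6 : sn b / sn a * md (mdist w v) <= sn b / sn a * jacobi (md t) z2 a.
  by rewrite ler_wpM2l// divr_ge0// ltW.
have h7 : sn b / sn a * jacobi (md t) z2 a =
  sn b / sn a * md a + sn b / sn a * cs a * md t +
  sn t * (- sn b * chord_slope k (md c) (md q) d / sn c).
  by rewrite /jacobi /z2; field; rewrite !gt_eqF.
by clear -k geoX h3 h4 h6 h7; lra.
Qed.

(* First-order form, as [t] tends to 0, of the hinge comparison at [y]: [w] lies on
   the extension of [x y] beyond [y], and [u] on [y p]. *)
Lemma hinge_before_corner p x y u w a b t z :
  mdist w y = t -> mdist y x = a -> mdist y u = a -> mdist p y = b ->
  mdist p u = b - a -> three_point k u w y x ->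
  md t + cs t * md b - sn t * z <= md (mdist p w) ->
  0 < sn a -> 0 < sn b -> 0 <= sn (b - a) -> subdiam (t + b) ->
  sn t * (md (mdist x u) - (md a + cs a * md a + sn a * (sn a / sn b * z))) <=
  (- k * sn a * md a + sn a - sn a * (sn a / sn b) * (1 - k * md b)) * md t.
Proof.
move=> wy yx yu py pu T low sa sb sba diam.
have h3 : md (mdist p w) <= md (mdist u w + (b - a)).
  apply: md_le_subdiam; first exact: mdist_ge0.
    by have := metric_triangle p u w; rewrite pu addrC.
  have := metric_triangle u y w.
  rewrite (metric_sym u y) yu (metric_sym y w) wy => h.
  by apply: le_subdiam diam; clear -k geoX h; lra.
have h4 := @md_add_le _ k (mdist u w) a (b - a) sba sa.
rewrite [a + _]addrC subrK in h4.
have h7 : sn a / sn b * (md t + cs t * md b - sn t * z - md b) <=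
  md (mdist u w) - md a.
  have -> : md (mdist u w) - md a =
    sn a / sn b * (sn b / sn a * (md (mdist u w) - md a)).
    by field; rewrite !gt_eqF.
  rewrite ler_wpM2l ?divr_ge0 ?(ltW sa) ?(ltW sb)//.
  by clear -k geoX h3 h4 low; lra.
move: T; rewrite /three_point wy yx (metric_sym u x) (metric_sym u y) yu.
have := ler_wpM2l (ltW sa) h7.
rewrite snD /cs; clear -k geoX; lra.
Qed.

(** The new corner [y'] lies on [u x] at distance [a] from [x]. Let [z] be the slope at [u] of the
    chord of [md (mdist p _)] on [u y'], and [V] the slope of the hinge at [y] seen from [u]. The
    path through the old corner gives [z <= V]; the chord prolonged to [x] is therefore below the
    old hinge, and it is above the new one. All points compared lie within [3 a] of [y]. The leg [q]
    is separate from [a] because the first step starts with a short one. *)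
Lemma cradle_step p x y u a q c d b fu :
  mdist y x = q -> mdist y u = c -> mdist u x = d -> mdist p y = b ->
  mdist p u = fu ->
  0 < a -> 0 < q -> q <= a -> q + c = 2 * a -> c + fu = b ->
  locally_three_point k y (5 * a) ->
  9 / 2 * a <= mdist p x -> 3 / 2 * a <= d ->
  subdiam (q + b) ->
  (forall w, mdist u w + mdist w x = d -> a < mdist w x ->
    semiconcave_at k p w) ->
  exists y' u',
  [/\ mdist y' x = a, mdist y' u' = a,
      mdist y' u' + mdist p u' = mdist p y',
      a + mdist p y' <= d + fu &
      hinge_md p x y' u' <= hinge_md p x y u].
Proof.
move=> yx yu ux py pu a0 q0 qa qc yup loc far d_lo diam conc.
have px : mdist p x <= b + q.
  by have := metric_triangle p y x; rewrite py yx.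
have dq : d <= 2 * a.
  by rewrite -qc -ux addrC -yx -yu (metric_sym y u); exact: metric_triangle.
have [a5 c5 q5 ca5] : [/\ 0 < 5 * a, c < 5 * a, q < 5 * a & c + a < 5 * a].
  by split; lra.
have tau0 : 0 < d - a by lra.
have fu_lo : 3 / 2 * a <= fu by lra.
have diamW t : t <= q + b -> subdiam t by move=> h; exact: le_subdiam h diam.
have snp t : 0 < t -> t <= q + b -> 0 < sn t.
  by move=> t0 h; apply: sn_gt0 => //; exact: diamW.
have sa : 0 < sn a.
  by apply: snp => //; move: q0 qa qc yup fu_lo; clear -k geoX; lra.
have sc : 0 < sn c.
  by apply: snp; move: a0 q0 qa qc yup fu_lo; clear -k geoX; lra.
have sd : 0 < sn d.
  by apply: snp; move: a0 q0 qc yup fu_lo dq d_lo; clear -k geoX; lra.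
have stau : 0 < sn (d - a).
  by apply: snp => //; move: a0 q0 qc yup fu_lo dq; clear -k geoX; lra.
have sfu : 0 < sn fu.
  by apply: snp; move: a0 q0 qa qc yup fu_lo; clear -k geoX; lra.
have [e [e0 ed ge]] := exists_geo geoX u x; rewrite ux in ed ge.
have d0 : 0 <= d by move: a0 tau0; clear -k geoX; lra.
have ude : 0 <= (0 : R) <= d by rewrite lexx.
have dde : 0 <= d <= d by rewrite lexx d0.
have ue t : 0 <= t <= d -> mdist u (e t) = t.
  by move=> td; rewrite -e0 ge// sub0r normrN ger0_norm//; case/andP: td.
have ex t : 0 <= t <= d -> mdist (e t) x = d - t.
  by move=> td; rewrite -ed ge// distrC ger0_norm// subr_ge0; case/andP: td.
have tdW t : 0 <= t <= d - a -> 0 <= t <= d 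
  by move=> /andP[t0 t1]; apply/andP; move: t0 t1 a0; clear -k geoX; split; lra.
have ye t : 0 <= t <= d - a -> mdist y (e t) < 5 * a.
  move=> ht; have td := tdW _ ht; case/andP: ht => t0 tt.
  by have := metric_triangle y u (e t); rewrite ue// yu;
    move: tt qa q0 qc dq; clear -k geoX; lra.
have fe t : 0 <= t <= d - a -> mdist p (e t) <= fu + t.
  by move=> /tdW td; have := metric_triangle p u (e t); rewrite ue// pu.
have [v [uv pv]] : exists v, mdist u v = a /\ mdist v p = fu - a.
  have := @exists_point_at _ _ geoX u p a; rewrite metric_sym pu; apply.
  by apply/andP; move: a0 fu_lo; clear -k geoX; split; lra.
rewrite metric_sym in pv.
have yv : mdist y v = c + a.
  apply/eqP; rewrite eq_le; apply/andP; split.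
    by have := metric_triangle y u v; rewrite yu uv.
  by have := metric_triangle p v y; rewrite (metric_sym v y) py pv;
    move: yup; clear -k geoX; lra.
have sfa : 0 <= sn (fu - a).
  by rewrite ltW// snp//; move: fu_lo yup q0 qc a0; clear -k geoX; lra.
pose y' := e (d - a); set b' := mdist p y'.
have tauI : 0 <= d - a <= d - a by rewrite lexx ltW.
have b'_hi : b' <= fu + (d - a) by exact: fe.
have y'x : mdist y' x = a by rewrite /y' ex ?tdW// opprB addrC subrK.
have b'_lo : 7 / 2 * a <= b'.
  by have := metric_triangle p y' x; rewrite y'x -/b'; move: far; clear -k geoX; lra.
have sb' : 0 < sn b'.
  by apply: snp; move: a0 b'_lo b'_hi dq yup qc q0; clear -k geoX; lra.
have [u' [y'u' pu']] : exists u', mdist y' u' = a /\ mdist u' p = b' - a.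
  have := @exists_point_at _ _ geoX y' p a; rewrite metric_sym -/b'; apply.
  by apply/andP; move: a0 b'_lo; clear -k geoX; split; lra.
rewrite metric_sym in pu'.
have sba : 0 <= sn (b' - a).
  by rewrite ltW// snp//; move: b'_lo b'_hi dq yup qc q0 a0; clear -k geoX; lra.
pose A := md fu.
pose z := chord_slope k A (md b') (d - a).
(* Semiconcavity is available only at distance more than [a] from [x], so the bound stops at [y'];
   beyond it only the formula of the solution is continued. *)
have low t : 0 <= t <= d - a -> jacobi A z t <= md (mdist p (e t)).
  apply: (@jacobi_le_geo _ k _ p e (d - a)) => //.
  - by apply: diamW; move: a0 q0 qc yup fu_lo dq; clear -k geoX; lra.
  - by move=> s t' hs ht'; apply: ge; exact: tdW.
  - move=> s /andP[s0 s1]; have sd' : 0 <= s <= d - a by rewrite !ltW.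
    by apply: conc; rewrite ?ue ?ex ?tdW//; move: s1; clear -k geoX; lra.
  - by rewrite e0 pu.
  - by rewrite jacobi_chord ?gt_eqF// -/y' -/b'.
have zE : jacobi A z (d - a) = md b' by rewrite jacobi_chord ?gt_eqF.
pose V := - sn fu * chord_slope k (md c) (md q) d / sn c.
(* [low] and [dist_past_corner] bound the same function from below and above and agree at [t = 0],
   so their slopes are ordered. *)
have zV : z <= V.
  rewrite -subr_le0.
  apply: (@le0_of_infinitesimal _ k _ (sn fu / sn a * cs a - 1 + k * A) _ tau0).
  move=> t /andP[t0 tt].
  have tI : 0 <= t <= d - a by rewrite tt ltW.
  have td := tdW _ tI.
  have T1 : three_point k y u (e t) x.
    by apply: loc; rewrite ?mdistxx ?yu ?yx ?ye// ue// ex// ux addrC subrK.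
  have T2 : three_point k (e t) y u v.
    by apply: loc; rewrite ?mdistxx ?yu ?uv ?yv ?ye.
  have diamt : subdiam (t + fu).
    by apply: diamW; move: tt dq qc yup a0; clear -k geoX; lra.
  have := dist_past_corner yx yu ux pu (ue t td) (ex t td) uv pv yv T1 T2
    sa sc sd sfu sfa diamt.
  have := low t tI.
  rewrite {1}/jacobi /A {1}/cs -/V; clear -k geoX; lra.
exists y', u'; rewrite -/b' y'x y'u' pu'; split=> //.
- by rewrite addrC subrK.
- by move: b'_hi; clear -k geoX; lra.
rewrite /hinge_md -/b' y'x y'u' yx yu py (metric_sym x u) ux.
set Q := md (mdist x u').
(* The slope of the chord solution on arrival at [y']. *)
pose z' := sn (d - a) * (1 - k * A) + cs (d - a) * z.
have hd : jacobi A z d = md a + cs a * md b' + sn a * z'.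
  have -> : d = d - a + a by ring.
  by rewrite jacobi_shift zE /jacobi.
have hQ : Q - (md a + cs a * md a + sn a * (sn a / sn b' * z')) <= 0.
  apply: (@le0_of_infinitesimal _ k _ (- k * sn a * md a + sn a -
    sn a * (sn a / sn b') * (1 - k * md b')) _ tau0).
  move=> t /andP[t0 tt].
  have tI : 0 <= d - a - t <= d - a.
    by apply/andP; move: t0 tt; clear -k geoX; split; lra.
  pose w := e (d - a - t).
  have wy : mdist w y' = t.
    by rewrite /w /y' ge ?tdW// addrAC subrr add0r normrN gtr0_norm.
  have wx : mdist w x = a + t by rewrite /w ex ?tdW//; clear -k geoX; ring.
  have yu' : mdist y u' < 5 * a.
    have := metric_triangle y x u'; have := metric_triangle x y' u'.
    by rewrite (metric_sym x y') y'x y'u' yx; move: qa a0; clear -k geoX; lra.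
  have T : three_point k u' w y' x.
    by apply: loc; rewrite ?yu' ?ye ?yx// wy y'x wx addrC.
  have diamt : subdiam (t + b').
    by apply: diamW; move: tt b'_hi dq qc yup qa a0; clear -k geoX; lra.
  apply: (hinge_before_corner wy y'x y'u' erefl pu' T) => //.
  have := low _ tI; rewrite -/w; congr (_ <= _).
  by rewrite jacobi_shift zE /jacobi mdN csN snN mulNr.
have hV : jacobi A V d = md q + cs q * md b +
    sn b / sn c * (md d - md q - cs q * md c) by apply: hinge_md_other_side; rewrite ?gt_eqF.
rewrite -hV; apply: (@le_trans _ _ (jacobi A z d)); last first.
  by rewrite /jacobi lerD2l ler_wpM2l// ltW.
rewrite hd.
have hh : sn b' / sn a * (Q - md a - cs a * md a) <= sn b' / sn a * (sn a * (sn a / sn b' * z')).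
  rewrite ler_wpM2l ?divr_ge0 ?(ltW sa) ?(ltW sb')//.
  by move: hQ; clear -k geoX; lra.
have e1 : sn b' / sn a * (sn a * (sn a / sn b' * z')) = sn a * z'.
  by move: sa sb'; clear -k geoX => sa sb; field; rewrite !gt_eqF.
by move: hh; rewrite e1; clear -k geoX; lra.
Qed.
End Cradle.

(** * Iteration of the cradle *)

Section CradleLimit.
Context {R : realType} (k : R) {X : metricType R}.
Local Notation sn := (sn k).
Local Notation cs := (cs k).
Local Notation md := (md k).
Local Notation subdiam := (subdiam k).
Local Notation hinge_md := (hinge_md k).
Hypothesis geoX : geodesic_space X.
Implicit Types (p x y u v w : X) (a b e q r s t : R).

Lemma sn_bound r : exists2 M : R, 0 < M &
  forall t, 0 <= t <= r -> subdiam r -> sn t <= M.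
Proof.
exists (1 + md r * (2 + `|k| * md r)).
  by rewrite ltr_wpDr// mulr_ge0 ?md_ge0// addr_ge0// mulr_ge0 ?md_ge0.
move=> t /andP[t0 tr] hr.
have h1 : sn t <= 1 + sn t ^+ 2.
  have : 0 <= (sn t - 1 / 2) ^+ 2 by exact: sqr_ge0.
  have -> : (sn t - 1 / 2) ^+ 2 = sn t ^+ 2 - sn t + 1 / 4 by field.
  lra.
apply: le_trans h1 _; rewrite lerD2l sn_sq.
have mm : md t <= md r by exact: md_le_subdiam.
have m0 := md_ge0 k t.
apply: le_trans (_ : md t * (2 + `|k| * md r) <= _); last first.
  by rewrite ler_wpM2r// addr_ge0// mulr_ge0// md_ge0.
rewrite ler_wpM2l//.
have : - (k * md t) <= `|k| * md r.
  apply: le_trans (ler_norm _) _; rewrite normrN normrM (ger0_norm m0).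
  by rewrite ler_wpM2l.
by rewrite /cs; lra.
Qed.

Lemma md_gap t e : 0 < e -> exists2 d : R, 0 < d &
  forall s, s <= t -> md s <= md t - e -> s <= t - d.
Proof.
move=> e0.
have := @cvgr_dist_lt R R^o _ _ _ md (md t) (@continuous_md R k t) _ e0.
move=> -[d /= d0 hd]; exists d => // s st hs.
rewrite leNgt; apply/negP => h.
have /hd/= : ball t d s by rewrite /ball/= ger0_norm; lra.
by move=> /(le_lt_trans (ler_norm _)); lra.
Qed.

(* Lang and Schroeder's cradle: each step keeps [hinge_md] from increasing and,
   as long as [md (mdist p x)] exceeds it, shortens the path from [x] to [p]
   through [y] by a fixed amount. *)
Section Limit.
Variables (p w x u : X) (a s : R).
Let r0 : R := s + mdist p w.

Lemma cradle_limit :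
  mdist w x = s -> mdist w u = 2 * a - s ->
  2 * a - s + mdist p u = mdist p w ->
  0 < s -> s <= a / 4 -> 5 * a <= mdist p w ->
  subdiam r0 ->
  (forall y, mdist y x + mdist p y <= r0 -> locally_three_point k y (5 * a)) ->
  (forall v, mdist v x + mdist p v <= r0 -> a < mdist v x ->
     semiconcave_at k p v) ->
  md (mdist p x) <= hinge_md p x w u.
Proof.
move=> wx wu pu s0 sa pw diam loc conc.
have px : mdist p w - s <= mdist p x.
  by have := metric_triangle p x w; rewrite (metric_sym x) wx; lra.
have a0 : 0 < a by lra.
set S0 := hinge_md p x w u.
have step y v q c : mdist y x = q -> mdist y v = c -> 0 < q -> q <= a ->
    q + c = 2 * a -> c + mdist p v = mdist p y -> q + mdist p y <= r0 ->
    hinge_md p x y v <= S0 ->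
  exists y' v', [/\ mdist y' x = a, mdist y' v' = a,
      a + mdist p v' = mdist p y', a + mdist p y' <= mdist v x + mdist p v &
      hinge_md p x y' v' <= S0].
  move=> yx yv q0 qa qc yvp yr hS.
  have vxr : mdist v x + mdist p v <= r0.
    by have := metric_triangle v y x; rewrite (metric_sym v y) yv yx; lra.
  have [|||||y' [v' [h1 h2 h3 h4 h5]]] := @cradle_step _ k _ geoX p x y v a q c
    (mdist v x) (mdist p y) (mdist p v) yx yv erefl erefl erefl a0 q0 qa qc yvp.
  - by apply: loc; rewrite yx.
  - by lra.
  (* The origin of [s <= a / 4]: the path has length at most |p w| + s and |p x| >= |p w| - s, so |v
     x| >= 2 a - 2 s >= 3/2 a. *)
  - have := metric_triangle p v x; rewrite /r0 in yr *; lra.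
  - by apply: le_subdiam diam.
  - move=> z zx az; apply: conc => //.
    by have := metric_triangle p v z; lra.
  exists y', v'; rewrite h2 in h3; split => //; exact: le_trans h5 hS.
rewrite leNgt; apply/negP => lt0.
have ps : subdiam (mdist p x).
  by apply: le_subdiam diam; have := metric_triangle p w x; rewrite /r0 wx; lra.
have [M M0 hM] := sn_bound r0.
have saP : 0 < sn a by apply: sn_gt0 => //; apply: le_subdiam diam; rewrite /r0; lra.
(* A lower bound for [md (2 a) - md |v x|] at every step, as long as the claim fails; [md_gap] turns
   it into a fixed loss [d] of length. *)
pose e := (md (mdist p x) - S0) * sn a / M.
have e0 : 0 < e by rewrite divr_gt0// mulr_gt0// subr_gt0.
have [d d0 hd] := md_gap (2 * a) e0.
have iter n : exists y v, [/\ mdist y x = a, mdist y v = a,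
    a + mdist p v = mdist p y, a + mdist p y <= r0 - n%:R * d &
    hinge_md p x y v <= S0].
  elim: n => [|n [y [v [yx yv yvp yr hS]]]].
    (* The first step has legs [s] and [2 a - s]; from then on both legs equal [a]. *)
    have [|||||y [v [h1 h2 h3 h4 h5]]] := step w u s (2 * a - s) wx wu s0.
    - by lra.
    - by lra.
    - by [].
    - by [].
    - by [].
    exists y, v; split => //; rewrite mul0r subr0; apply: le_trans h4 _.
    have := metric_triangle u w x; rewrite (metric_sym u w) wx wu /r0; lra.
  have nd : 0 <= n%:R * d by rewrite mulr_ge0// ltW.
  have yr' : a + mdist p y <= r0 by lra.
  have [||||y' [v' [h1 h2 h3 h4 h5]]] := step y v a a yx yv a0 (lexx a).
  - by ring.
  - by [].
  - by [].
  - by [].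
  exists y', v'; split => //; apply: le_trans h4 _.
  suff : mdist v x <= 2 * a - d by rewrite -natr1 mulrDl mul1r; lra.
  apply: hd.
    by have := metric_triangle v y x; rewrite (metric_sym v y) yv yx; lra.
  have le1 : md (mdist p x) <= md (a + mdist p y).
    apply: md_le_subdiam; first exact: mdist_ge0.
      by have := metric_triangle p y x; rewrite yx; lra.
    exact: le_subdiam diam.
  have sb : 0 <= sn (mdist p y).
    apply: sn_ge0; first exact: mdist_ge0.
    by apply: le_subdiam diam; lra.
  have sbM : sn (mdist p y) <= M.
    by apply: hM => //; rewrite mdist_ge0/=; lra.
  (* A straight hinge would give [md (a + |p y|) >= md |p x|]; the remaining term measures how far
     the corner at [y] is from straight. *)
  have hE : hinge_md p x y v = md (a + mdist p y) -
      sn (mdist p y) / sn a * (md (2 * a) - md (mdist v x)).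
    have -> : 2 * a = a + a by ring.
    rewrite /hinge_md yx yv (metric_sym x) !mdD /cs.
    by field; rewrite gt_eqF.
  have dd : 0 <= md (2 * a) - md (mdist v x).
    rewrite subr_ge0; apply: md_le_subdiam; first exact: mdist_ge0.
      by have := metric_triangle v y x; rewrite (metric_sym v y) yv yx; lra.
    by apply: le_subdiam diam; rewrite /r0; lra.
  have : md (mdist p x) - S0 <= M / sn a * (md (2 * a) - md (mdist v x)).
    apply: le_trans (_ : sn (mdist p y) / sn a * (md (2 * a) - md (mdist v x)) <= _).
      by lra.
    by rewrite ler_wpM2r// ler_wpM2r// invr_ge0 ltW.
  have -> : M / sn a * (md (2 * a) - md (mdist v x)) =
    (md (2 * a) - md (mdist v x)) / (sn a / M) by field; rewrite !gt_eqF.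
  rewrite ler_pdivlMr ?divr_gt0// mulrA -/e; lra.
have [y [v [yx yv yvp yr hS]]] := iter (Num.bound (r0 / d)).
have r00 : 0 <= r0 by rewrite addr_ge0 ?mdist_ge0// ltW.
have := archi_boundP (_ : 0 <= r0 / d); rewrite divr_ge0 ?(ltW d0)// => /(_ isT).
rewrite ltr_pdivrMr// => h.
by have := mdist_ge0 p y; lra.
Qed.

End Limit.
End CradleLimit.

(** * Second differences in a region of uniform scale *)

Section TubeSemiconcavity.
Context {R : realType} (k : R) {X : metricType R}.
Local Notation sn := (sn k).
Local Notation cs := (cs k).
Local Notation md := (md k).
Local Notation subdiam := (subdiam k).
Local Notation hinge_md := (hinge_md k).
Hypothesis geoX : geodesic_space X.
Implicit Types (p x y u v w z : X) (a b e q r s t : R).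

(** The three-point inequality at the midpoint [w], seen from [u], says that the cosines of the
    model angles of [w x u] and [w y u] at [w] have a nonnegative sum; so the angle terms of the two
    hinges together contribute at most 0. *)
Lemma hinge_md_pair p w u x y s c : 0 < sn s -> 0 < sn c ->
  0 <= sn (mdist p w) ->
  mdist w x = s -> mdist w y = s -> mdist x y = 2 * s -> mdist w u = c ->
  three_point k u x w y ->
  hinge_md p x w u + hinge_md p y w u <=
  2 * md s + 2 * cs s * md (mdist p w).
Proof.
move=> ss sc sb wx wy xy wu.
rewrite /three_point (metric_sym x) wx wy /hinge_md wx wy wu snD.
rewrite (metric_sym u x) (metric_sym u y) (metric_sym u w) wu => h.
have {h} : sn s * (md (mdist x u) + md (mdist y u)) <=
  sn s * (2 * cs s * md c + 2 * md s) by lra.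
rewrite ler_pM2l// => h.
have : sn (mdist p w) / sn c * (md (mdist x u) + md (mdist y u)) <=
  sn (mdist p w) / sn c * (2 * cs s * md c + 2 * md s).
  by rewrite ler_wpM2l// divr_ge0// ltW.
lra.
Qed.

Section Tube.
Variables (p z : X) (l a : R).

Let tube w : Prop := mdist z w + mdist p w < l.

Lemma tube_semiconcave : 0 < a -> subdiam l ->
  (forall w, tube w -> locally_three_point k w (5 * a)) ->
  forall w, tube w -> semiconcave_at k p w.
Proof.
move=> a0 diam loc.
suff H m w : tube w -> mdist p w < m%:R * a -> semiconcave_at k p w.
  move=> w tw; apply: (H (Num.bound (mdist p w / a))) => //.
  rewrite -ltr_pdivrMr//.
  by apply: archi_boundP; rewrite divr_ge0 ?mdist_ge0 ?ltW.
elim: m w => [w _|m IH w tw]; first by rewrite mul0r ltNge mdist_ge0.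
rewrite -natr1 mulrDl mul1r => wm.
have a5 : 0 < 5 * a by rewrite mulr_gt0.
(* The constant serves twice: below it [p] lies in the local ball of [w], above it |p x| is at least
   the [9/2 a] required by the cradle. *)
have [lt5|ge5] := ltP (mdist p w) (5 * a).
  apply: (@locally_three_point_semiconcave _ k _ p w (5 * a)) => //.
    by rewrite metric_sym.
  exact: loc.
move=> eta eta0.
(* The three bounds on [s] serve the cradle, the induction, and the inclusion of all cradle points
   in the tube: their distances to [z] and [p] add up to at most those of [w] plus [2 s]. *)
pose e := Num.min (a / 4) (Num.min (m%:R * a + a - mdist p w)
  ((l - mdist z w - mdist p w) / 2)).
have e0 : 0 < e.
  rewrite !lt_min divr_gt0//= subr_gt0 wm divr_gt0//.
  by move: tw; rewrite /tube; lra.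
exists e => // s x y /andP[s0 se] wx wy xy.
move: (se); rewrite !lt_min => /and3P[sa sm sl].
have r0l : mdist z w + mdist p w + 2 * s < l.
  by rewrite ltr_pdivlMr// in sl; lra.
have zw0 := mdist_ge0 z w.
have [u [wu up]] : exists u, mdist w u = 2 * a - s /\ mdist u p = mdist w p - (2 * a - s).
  apply: exists_point_at => //; rewrite (metric_sym w p).
  by apply/andP; split; lra.
rewrite metric_sym (metric_sym w) in up.
have lim v : mdist w v = s -> md (mdist p v) <= hinge_md p v w u.
  move=> wv; apply: (@cradle_limit _ k _ geoX p w v u a s) => //.
  - by rewrite up; ring.
  - exact: ltW.
  - by apply: le_subdiam diam; lra.
  - move=> y' hy; apply: loc; rewrite /tube.
    have := metric_triangle z v y'; have := metric_triangle z w v.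
    by rewrite (metric_sym v) wv; lra.
  (* A path of length at most |p w| + s < (m + 1) a that has already used more than [a] leaves less
     than [m a] to [p]. *)
  - move=> y' hy ay; apply: IH; last by lra.
    rewrite /tube; have := metric_triangle z v y'; have := metric_triangle z w v.
    by rewrite (metric_sym v) wv; lra.
have diamW t : t <= mdist p w -> subdiam t.
  by move=> h; apply: le_subdiam diam; lra.
have T : three_point k u x w y.
  have sa5 : s < 5 * a by lra.
  apply: (loc _ tw); rewrite ?mdistxx ?wx ?wy//; first by rewrite wu; lra.
  by rewrite (metric_sym x) wx xy; lra.
have ss : 0 < sn s by apply: sn_gt0 => //; apply: diamW; lra.
have sc : 0 < sn (2 * a - s) by apply: sn_gt0; [lra|apply: diamW; lra].
have sb : 0 <= sn (mdist p w) by apply: sn_ge0; [exact: mdist_ge0|exact: diamW].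
have := hinge_md_pair ss sc sb wx wy xy wu T.
have := lim _ wx; have := lim _ wy.
have : 0 <= md s * eta by rewrite mulr_ge0 ?md_ge0// ltW.
rewrite /cs; lra.
Qed.

End Tube.
End TubeSemiconcavity.

(** * The region around a geodesic *)

Section Tube.
Context {R : realType} (k : R) {X : metricType R}.
Local Notation sn := (sn k).
Local Notation cs := (cs k).
Local Notation md := (md k).
Local Notation subdiam := (subdiam k).
Hypothesis geoX : geodesic_space X.
Hypothesis locX : forall w : X, exists2 r : R, 0 < r & locally_three_point k w r.
Implicit Types (p x y u v w z : X) (a b e q r s t : R).

Lemma locally_three_pointW w v r t : mdist w v + t <= r ->
  locally_three_point k w r -> locally_three_point k v t.
Proof.
move=> wv H p x y z vp vx vy vz; apply: H.
- by have := metric_triangle w v p; lra.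
- by have := metric_triangle w v x; lra.
- by have := metric_triangle w v y; lra.
- by have := metric_triangle w v z; lra.
Qed.

(** Compactness of [0, L]: a radius [r] at [t] leaves [r / 2] at all parameters within [r / 2] of
    [t]. *)
Lemma uniform_radius (g : R -> X) L : is_geo g L ->
  exists2 r : R, 0 < r & forall t, 0 <= t <= L -> locally_three_point k (g t) r.
Proof.
move=> gg.
have /compact_near_coveringP/near_covering_withinP H := @segment_compact R 0 L.
have [|r [r0 hr]] := filter_ex (filterI (@nbhs_right_gt R 0)
  (H R (0 : R)^'+ (fun r t => locally_three_point k (g t) r) _ _)).
  move=> t; rewrite /= in_itv/= => tL.
  have [r r0 hr] := locX (g t).
  near=> t' i => /=; rewrite in_itv/= => t'L.
  apply: locally_three_pointW hr; rewrite gg//.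
  have i2 : i < r / 2 by near: i; apply: nbhs_right_lt; rewrite divr_gt0.
  have t2 : `|t - t'| < r / 2.
    near: t'; apply: (@cvgr_dist_lt R R^o _ _ _ id t); first exact: cvg_id.
    by rewrite divr_gt0.
  lra.
exists r => // t tL; apply: hr; rewrite /= in_itv//.
Unshelve. all: by end_near. Qed.

Lemma subdiam_open t : 0 <= t -> subdiam t -> exists2 e : R, 0 < e & subdiam (t + e).
Proof.
move=> t0 ht; case: (ltP 0 k) => k0; last first.
  by exists 1 => // /lt_le_trans /(_ k0); rewrite ltxx.
have := ht k0; set c := curv_rad k => h.
have c0 : 0 < c by apply: curv_rad_gt0; rewrite gt_eqF.
exists ((pi - c * t) / (2 * c)) => [|_].
  by rewrite divr_gt0 ?mulr_gt0// subr_gt0.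
rewrite -/c mulrDr (_ : c * ((pi - c * t) / (2 * c)) = (pi - c * t) / 2); last first.
  by field; rewrite gt_eqF.
lra.
Qed.

Lemma near0_lt (F : R -> R) c : F 0 < c -> {for 0, continuous F} ->
  exists2 d : R, 0 < d & forall t, 0 <= t < d -> F t < c.
Proof.
move=> Fc cF; have cF0 : 0 < c - F 0 by rewrite subr_gt0.
have := @cvgr_dist_lt R R^o _ _ _ F (F 0) cF _ cF0.
move=> -[d /= d0 hd]; exists d => // t /andP[t0 td].
have /hd/= : ball 0 d t by rewrite /ball/= sub0r normrN ger0_norm.
by rewrite distrC => /(le_lt_trans (ler_norm _)); lra.
Qed.

(** Non-branching in quantitative form. For [q = 0] the three-point inequality at [A], seen from
    [y], gives [md |y Q| <= 2 cs b md b + 2 md b - md (2 b) = 0]; the last hypothesis says that [q]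
    is small enough to keep this below [md e]. *)
Lemma almost_straight_step y P A Q b q e : mdist P A = b -> mdist A Q = b ->
  three_point k y P A Q -> 0 < b -> 0 < q -> q <= b -> 0 <= e ->
  subdiam (4 * b) -> mdist y A <= b + q -> 2 * b - q <= mdist y P ->
  2 * cs b * md (b + q) + 2 * md b - md (2 * b - q) < md e ->
  mdist y Q < e.
Proof.
move=> PA AQ + b0 q0 qb e0 b4 yA yP F.
have diamW (u : R) : u <= 4 * b -> subdiam u by move=> h; apply: le_subdiam b4.
have cb : 0 < cs b.
  by apply: cs_gt0; [exact: ltW|apply: diamW; move: b0; clear -k geoX locX; lra].
have sb : 0 < sn b by apply: sn_gt0 => //; apply: diamW; lra.
rewrite /three_point PA AQ snD => h.
have {h} : sn b * (md (mdist y P) + md (mdist y Q)) <=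
  sn b * (2 * cs b * md (mdist y A) + 2 * md b) by lra.
rewrite ler_pM2l// => h.
have yP4 : mdist y P <= 4 * b.
  by have := metric_triangle y A P; rewrite (metric_sym A) PA; lra.
have yQ4 : mdist y Q <= 4 * b.
  by have := metric_triangle y A Q; rewrite AQ; lra.
have i1 : md (2 * b - q) <= md (mdist y P).
  by apply: md_le_subdiam => //; [lra|exact: diamW].
have i2 : cs b * md (mdist y A) <= cs b * md (b + q).
  rewrite ler_pM2l//; apply: md_le_subdiam => //; first exact: mdist_ge0.
  by apply: diamW; lra.
apply: (@md_lt_inv _ k) => //; first exact: diamW.
by move: h i1 i2 F; clear -k geoX locX; lra.
Qed.

Section AroundGeodesic.
Variables (g : R -> X) (l r b d : R).
Hypotheses (gg : is_geo g l) (b0 : 0 < b) (bd : b <= d) (dl : d < l)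
  (br : 4 * b <= r) (b4 : subdiam (4 * b))
  (loc : forall t, 0 <= t <= l -> locally_three_point k (g t) r).
Let p := g d.
Let z := g l.

(* The part of [g] before [d] is what prevents branching: a point that almost
   realizes the distance from [z] to [p = g d] is, step by step, kept close to [g]
   by the comparison at [g (d + j b)]. *)
Lemma near_geodesic_stable (j : nat) e : d + j%:R * b <= l -> 0 < e ->
  exists2 s : R, 0 < s & forall y, mdist p y = j%:R * b ->
    mdist z y <= l - d - j%:R * b + s -> mdist y (g (d + j%:R * b)) <= e.
Proof.
elim: j e => [|j IH] e.
  move=> _ e0; exists 1 => // y; rewrite mul0r => /mdist_positivity <- _.
  by rewrite addr0 mdistxx ltW.
have [h1 h2 h3 h4] : [/\ is_geo g l, 0 < b, b <= d & d < l] by [].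
have h5 := br.
rewrite -natr1 mulrDl mul1r; set t := j%:R * b => tl e0.
have t0 : 0 <= t by rewrite mulr_ge0// ltW.
have [tI tbI tBI] : [/\ 0 <= d + t <= l, 0 <= d + t - b <= l & 0 <= d + t + b <= l].
  by split; apply/andP; split; lra.
have lI : 0 <= l <= l by rewrite lexx andbT; lra.
pose e1 := Num.min e b.
have e10 : 0 < e1 by rewrite lt_min e0.
have [e1e e1b] : e1 <= e /\ e1 <= b by split; rewrite ge_min lexx ?orbT.
have diamW (u : R) : u <= 4 * b -> subdiam u by move=> h; apply: le_subdiam b4.
have [||d1 d10 hd1] := @near0_lt (fun s => 2 * cs b * md (b + s) + 2 * md b -
  md (2 * b - s)) (md e1).
(* At [s = 0] the expression vanishes, by the duplication formula for [md]. *)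
- rewrite addr0 subr0 (_ : 2 * b = b + b); last by ring.
  rewrite mdD -expr2 sn_sq /cs.
  suff : 0 < md e1 by lra.
  by apply: md_gt0 => //; apply: diamW; lra.
- have cm (u : R) : {for 0, continuous (fun s : R => md (u + s))}.
    apply: (@continuous_comp _ _ _ (fun s : R => u + s) md).
      by apply: cvgD; [exact: cvg_cst|exact: cvg_id].
    exact: continuous_md.
  apply: cvgB.
    apply: cvgD; last exact: cvg_cst.
    by apply: cvgM; [exact: cvg_cst|exact: cm].
  apply: (@continuous_comp _ _ _ (fun s : R => 2 * b - s) md).
    by apply: cvgB; [exact: cvg_cst|exact: cvg_id].
  exact: continuous_md.
pose eta := Num.min (d1 / 2) b.
have eta0 : 0 < eta by rewrite lt_min divr_gt0.
have etad : eta < d1 by rewrite gt_min; apply/orP; left; lra.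
have etab : eta <= b by rewrite ge_min lexx orbT.
have F0 : 2 * cs b * md (b + eta) + 2 * md b - md (2 * b - eta) < md e1.
  by apply: hd1; rewrite etad ltW.
have [|s1 s10 hs1] := IH eta _ eta0; first by rewrite -/t; lra.
exists (Num.min s1 eta) => [|y py zy]; first by rewrite lt_min s10.
have [ms1 meta] : Num.min s1 eta <= s1 /\ Num.min s1 eta <= eta.
  by split; rewrite ge_min lexx ?orbT.
(* One step back towards [p]: [v] satisfies the induction hypothesis with the same excess over the
   distance to [z]. *)
have [v [pv vy]] : exists v, mdist p v = t /\ mdist v y = b.
  have [|v [v1 v2]] := @exists_point_at _ _ geoX p y t.
    by rewrite py; apply/andP; split; lra.
  by exists v; split => //; rewrite v2 py; ring.
have zv : mdist v (g (d + t)) <= eta.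
  apply: hs1 => //; rewrite -/t.
  by have := metric_triangle z y v; rewrite (metric_sym y) vy; lra.
set A := g (d + t) in zv; set P := g (d + t - b); set Q := g (d + t + b).
have PA : mdist P A = b.
  by rewrite gg// addrAC subrr add0r normrN gtr0_norm.
have AQ : mdist A Q = b.
  by rewrite gg// opprD addNKr normrN gtr0_norm.
have PQ : mdist P Q = 2 * b.
  rewrite gg// distrC (_ : _ - _ = 2 * b); last by ring.
  by rewrite gtr0_norm// mulr_gt0.
have zP : mdist z P = l - d - t + b.
  rewrite gg// (_ : _ - _ = l - d - t + b); last by ring.
  by rewrite ger0_norm//; lra.
have yA : mdist y A <= b + eta.
  by have := metric_triangle y v A; rewrite (metric_sym y v) vy; lra.
have yP : 2 * b - eta <= mdist y P.
  by have := metric_triangle z y P; rewrite zP; lra.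
have r0 : 0 < r by lra.
have := loc tI; rewrite -/A => locA.
have : three_point k y P A Q.
  apply: locA; rewrite ?mdistxx ?AQ ?PA ?PQ //.
  - by rewrite metric_sym; lra.
  - by rewrite metric_sym PA; lra.
  - lra.
  - ring.
move=> T; apply: le_trans e1e; rewrite addrA -/Q ltW//.
exact: (almost_straight_step PA AQ T h2 eta0 etab (ltW e10) b4 yA yP F0).
Qed.

Lemma near_geodesic_stable_uniform (n : nat) :
  exists2 s : R, 0 < s & forall j : nat, (j <= n)%N -> d + j%:R * b <= l ->
    forall y, mdist p y = j%:R * b ->
    mdist z y <= l - d - j%:R * b + s -> mdist y (g (d + j%:R * b)) <= b.
Proof.
elim: n => [|n [s s0 hs]].
  have [s s0 hs] : exists2 s : R, 0 < s & forall y, mdist p y = 0%:R * b ->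
    mdist z y <= l - d - 0%:R * b + s -> mdist y (g (d + 0%:R * b)) <= b.
    by apply: near_geodesic_stable => //; rewrite mul0r addr0; exact: ltW.
  by exists s => // j; rewrite leqn0 => /eqP -> _.
case: (leP (d + n.+1%:R * b) l) => hn; last first.
  exists s => // j; rewrite leq_eqVlt => /orP[/eqP ->|jn]; last exact: hs.
  by rewrite leNgt hn.
have [s' s'0 hs'] := near_geodesic_stable hn b0.
exists (Num.min s s') => [|j]; first by rewrite lt_min s0.
have [m1 m2] : Num.min s s' <= s /\ Num.min s s' <= s'.
  by split; rewrite ge_min lexx ?orbT.
rewrite leq_eqVlt => /orP[/eqP ->|jn] jl y py zy.
  by apply: hs' => //; lra.
by apply: hs => //; lra.
Qed.

(** Round |p w| down to a multiple of [b]: the point at that distance on a geodesic [p w] is within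
    [b] of [g] by stability and within [b] of [w]. *)
Lemma near_geodesic_tube : exists2 s : R, 0 < s & s <= d /\
  forall w, mdist z w + mdist p w < l - d + s ->
    exists2 t, 0 <= t <= l & mdist w (g t) <= 2 * b.
Proof.
have [h1 h2 h3 h4] : [/\ is_geo g l, 0 < b, b <= d & d < l] by [].
pose n := Num.bound ((l - d) / b).
have [s s0 hs] := near_geodesic_stable_uniform n.
pose m := Num.min s b.
have [m1 m2] : m <= s /\ m <= b by split; rewrite ge_min lexx ?orbT.
have m0 : 0 < m by rewrite lt_min s0.
exists m => //; split; first exact: le_trans h3.
move=> w hw; set T := mdist p w in hw.
have T0 : 0 <= T by exact: mdist_ge0.
(* Beyond distance [l - d] from [p] there is no room for rounding on [g], but then [w] is within
   [m <= b] of [z]. *)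
case: (leP T (l - d)) => Tl; last first.
  exists l; first by apply/andP; split; lra.
  by rewrite metric_sym -/z; lra.
pose j := Num.truncn (T / b).
have Tb0 : 0 <= T / b by rewrite divr_ge0// ltW.
have /andP[] := truncn_itv Tb0; rewrite -/j ler_pdivlMr// ltr_pdivrMr// => j1 j2.
have jn : (j <= n)%N.
  rewrite -(ler_nat R); apply: le_trans (_ : T / b <= _).
    by rewrite ler_pdivlMr.
  apply: le_trans (_ : (l - d) / b <= _); first by rewrite ler_pM2r ?invr_gt0.
  by rewrite ltW// archi_boundP// divr_ge0 ?subr_ge0// ltW.
have j0 : 0 <= j%:R * b by rewrite mulr_ge0// ltW.
have [|v [pv vw]] := @exists_point_at _ _ geoX p w (j%:R * b).
  by rewrite j0.
exists (d + j%:R * b); first by apply/andP; split; lra.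
have := metric_triangle w v (g (d + j%:R * b)).
rewrite (metric_sym w v) vw -/T.
have : mdist v (g (d + j%:R * b)) <= b.
  apply: (hs j) => //; first lra.
  by have := metric_triangle z w v; rewrite (metric_sym w v) vw -/T; lra.
by rewrite -natr1 mulrDl mul1r in j2; lra.
Qed.

End AroundGeodesic.
End Tube.

(** * From interior points of a geodesic to its endpoint *)

Section GlobalSemiconcavity.
Context {R : realType} (k : R) {X : metricType R}.
Local Notation sn := (sn k).
Local Notation cs := (cs k).
Local Notation md := (md k).
Local Notation subdiam := (subdiam k).
Hypothesis geoX : geodesic_space X.
Hypothesis locX : forall w : X, exists2 r : R, 0 < r & locally_three_point k w r.
Implicit Types (p x y u v w z : X) (a b e q r s t : R).

Lemma semiconcave_inside (g : R -> X) l d : is_geo g l -> 0 < d -> d < l ->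
  subdiam l -> semiconcave_at k (g d) (g l).
Proof.
move=> gg d0 dl hl.
have [r r0 hr] := uniform_radius locX gg.
have [e1 e10 he1] := exists_subdiam k.
pose b := Num.min (r / 8) (Num.min d (e1 / 4)).
have b0 : 0 < b by rewrite !lt_min !divr_gt0// d0.
have := lexx b; rewrite {2}/b !le_min => /and3P[br bd be].
have b4r : 4 * b <= r by lra.
have b4 : subdiam (4 * b) by apply: le_subdiam he1; lra.
have [s s0 [sd hs]] := near_geodesic_tube geoX gg b0 bd dl b4r b4 hr.
have I1 : 0 <= d <= l by rewrite !ltW.
have I2 : 0 <= l <= l by rewrite lexx andbT; lra.
have gl : mdist (g d) (g l) = l - d by rewrite gg// distrC gtr0_norm// subr_gt0.
(* The tube is within [2 b] of [g] and [3 b <= r], so radius [b = 5 (b / 5)] works at all its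
   points; [s <= d] keeps its size at most [l]. *)
apply: (@tube_semiconcave _ k _ geoX (g d) (g l) (l - d + s) (b / 5)).
- by rewrite divr_gt0.
- by apply: le_subdiam hl; lra.
- move=> w /hs [t tl wt]; rewrite (_ : 5 * (b / 5) = b); last by field.
  by apply: locally_three_pointW (hr t tl); rewrite metric_sym; lra.
- by rewrite mdistxx add0r gl ltrDl.
Qed.

Lemma semiconcave_everywhere p z : subdiam (mdist p z) -> semiconcave_at k p z.
Proof.
set l := mdist p z => hl.
have : 0 <= l by exact: mdist_ge0.
rewrite le_eqVlt => /orP[/eqP l0|l0].
  move=> eta eta0; exists 1 => // s x y /andP[s0 _] zx zy _.
  have pz : p = z by apply: mdist_positivity.
  rewrite pz zx zy mdistxx md0 !mulr0 !subr0.
  have : 0 <= md s * eta by rewrite mulr_ge0 ?md_ge0// ltW.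
  lra.
have [g [g0 g1 gg]] := exists_geo geoX p z; rewrite -/l in g1 gg.
have sl : 0 < sn l by exact: sn_gt0.
move=> eta eta0.
(* Passing from [g d] to [p] costs [sn d / sn (l - d)], which is made smaller than [eta / 2]; the
   other half of [eta] goes to the semiconcavity for [g d]. *)
have [||d1 d10 hd1] := @near0_lt _ (fun s => sn s - eta / 2 * sn (l - s)) 0.
- by rewrite sn0 subr0 sub0r oppr_lt0 mulr_gt0// divr_gt0.
- apply: cvgB; first exact: continuous_sn.
  apply: cvgM; first exact: cvg_cst.
  apply: (@continuous_comp _ _ _ (fun s : R => l - s) sn).
    by apply: cvgB; [exact: cvg_cst|exact: cvg_id].
  exact: continuous_sn.
pose d := Num.min (d1 / 2) (l / 2).
have d0 : 0 < d by rewrite lt_min !divr_gt0.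
have dd1 : d <= d1 / 2 by rewrite ge_min lexx.
have dl2 : d <= l / 2 by rewrite ge_min lexx orbT.
have dl : d < l by lra.
have sd : sn d - eta / 2 * sn (l - d) < 0 by apply: hd1; apply/andP; split; lra.
pose u0 := l - d.
have u00 : 0 < u0 by rewrite subr_gt0.
have su : 0 < sn u0 by apply: sn_gt0 => //; apply: le_subdiam hl; rewrite /u0; lra.
have snd : 0 <= sn d by apply: sn_ge0; [exact: ltW|apply: le_subdiam hl; lra].
pose B := sn l / sn u0.
have B0 : 0 < B by rewrite divr_gt0.
have := semiconcave_inside gg d0 dl hl; rewrite g1.
have eB : 0 < eta / (2 * B) by rewrite divr_gt0// mulr_gt0.
move=> /(_ _ eB) [e e0 he].
have [e2 e20 he2] := subdiam_open (ltW l0) hl.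
exists (Num.min e e2); first by rewrite lt_min e0.
move=> s x y /andP[s0]; rewrite lt_min => /andP[se se2] zx zy xy.
have I1 : 0 <= d <= l by rewrite !ltW.
have I2 : 0 <= l <= l by rewrite lexx andbT ltW.
have I0 : 0 <= (0 : R) <= l by rewrite lexx ltW.
have gz : mdist (g d) z = u0 by rewrite -g1 gg// distrC gtr0_norm// subr_gt0.
have pg : mdist p (g d) = d by rewrite -g0 gg// sub0r normrN gtr0_norm.
have lE : u0 + d = l by rewrite /u0 subrK.
have push v : mdist z v = s ->
    md (mdist p v) <= md l + B * (md (mdist (g d) v) - md u0).
  move=> zv.
  have h1 : md (mdist p v) <= md (mdist (g d) v + d).
    apply: md_le_subdiam; first exact: mdist_ge0.
      by have := metric_triangle p (g d) v; lra.
    apply: le_subdiam he2; have := metric_triangle (g d) z v.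
    by rewrite gz zv; lra.
  apply: le_trans h1 _; rewrite /B -lE; exact: md_add_le.
have sa : 0 < s < e by rewrite s0.
have := he s x y sa zx zy xy; rewrite gz => h.
have h2 : B * (md (mdist (g d) x) + md (mdist (g d) y) - 2 * md u0) <=
  B * (2 * md s * (1 - k * md u0 + eta / (2 * B))) by rewrite ler_pM2l.
have := push x zx; have := push y zy => h3 h4.
rewrite -/l.
have BE : B * (1 - k * md u0) <= (1 - k * md l) + eta / 2.
  (* The subtraction formula for [d = l - u0]; the summand [sn d] is the whole transfer error. *)
  have e3 : sn l * cs u0 = cs l * sn u0 + sn d.
    have := snD k l (- u0); rewrite snN csN (_ : l - u0 = d) => [->|]; first ring.
    by rewrite /u0; ring.
  rewrite -[1 - k * md u0]/(cs u0) -[1 - k * md l]/(cs l) /B mulrAC e3.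
  rewrite mulrDl mulfK ?gt_eqF// lerD2l ler_pdivrMr//.
  by rewrite -/u0 in sd; move: sd; clear -k geoX locX; lra.
have h5 : 2 * md s * (B * (1 - k * md u0)) <= 2 * md s * ((1 - k * md l) + eta / 2).
  by rewrite ler_wpM2l// mulr_ge0 ?md_ge0.
have h6 : B * (2 * md s * (1 - k * md u0 + eta / (2 * B))) =
  2 * md s * (B * (1 - k * md u0)) + 2 * md s * (eta / 2).
  by field; rewrite gt_eqF.
move: h2 h3 h4 h5 h6; clear -k geoX locX; lra.
Qed.

Lemma global_chord p (c : R -> X) L : 0 < L -> subdiam L -> is_geo c L ->
  (forall t, 0 < t < L -> subdiam (mdist p (c t))) ->
  forall t, 0 <= t <= L ->
  jacobi k (md (mdist p (c 0)))
    (chord_slope k (md (mdist p (c 0))) (md (mdist p (c L))) L) t <=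
  md (mdist p (c t)).
Proof.
move=> L0 hL gc hp; apply: jacobi_le_geo => //.
  by move=> t /hp; exact: semiconcave_everywhere.
by rewrite jacobi_chord// gt_eqF// sn_gt0.
Qed.

End GlobalSemiconcavity.

(** * Angles in the model planes *)

Section ModelPlaneTrigonometry.
Context {R : realType} (k : R).
Local Notation sn := (sn k).
Local Notation cs := (cs k).
Local Notation md := (md k).
Local Notation q := (curv_rad k).
Implicit Types (p x y : 'rV[R]_3) (a b c t : R).

(** [md] of the model distance written as a polynomial in the coordinates, so that the law of
    cosines becomes an algebraic identity. *)
Definition model_md p x : R :=
  if k == 0 then model_form k (x - p) (x - p) / 2
  else (1 - k * model_form k p x) / k.

Lemma model_dirE p x y : model_plane k p ->
  model_form k (model_dir k p x) (model_dir k p y) =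
  model_md p x + model_md p y - k * model_md p x * model_md p y - model_md x y.
Proof.
rewrite /model_plane /model_md /model_dir/=; case: eqP => [->|/eqP k0].
  by move=> _; rewrite /model_form !mxE sgr0; field.
move=> [+ _]; rewrite /model_form !mxE => h; apply/eqP; rewrite -subr_eq0; apply/eqP.
set L := (X in X = 0).
suff : k * L = 0 by move/eqP; rewrite mulf_eq0 (negbTE k0) => /eqP.
have {}h : k * (Num.sg k * p 0 0 * p 0 0 + p 0 1 * p 0 1 + p 0 2 * p 0 2) - 1 = 0.
  by rewrite h subrr.
(* [E] is the quotient of [k L] by [k <p, p> - 1], which vanishes on the model plane. *)
pose E := (k * (Num.sg k * p 0 0 * x 0 0 + p 0 1 * x 0 1 + p 0 2 * x 0 2)) *
  (k * (Num.sg k * p 0 0 * y 0 0 + p 0 1 * y 0 1 + p 0 2 * y 0 2)).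
rewrite (_ : k * L = E * (k * (Num.sg k * p 0 0 * p 0 0 + p 0 1 * p 0 1 + p 0 2 * p 0 2) - 1)).
  by rewrite h mulr0.
by rewrite /L /E; field.
Qed.

Lemma model_mdxx p : model_plane k p -> model_md p p = 0.
Proof.
rewrite /model_plane /model_md/=; case: eqP => [k0 _|_ [-> _]].
  by rewrite /model_form !mxE !subrr !mulr0 !addr0 mul0r.
by rewrite subrr mul0r.
Qed.

Lemma model_dir_norm p x : model_plane k p -> model_plane k x ->
  model_form k (model_dir k p x) (model_dir k p x) =
  2 * model_md p x - k * model_md p x ^+ 2.
Proof. by move=> hp hx; rewrite model_dirE// model_mdxx//; ring. Qed.

Lemma arcosh_cosh t : 0 <= t -> arcosh ((expR t + expR (- t)) / 2) = t.
Proof.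
move=> t0; rewrite /arcosh expRN; set e := expR t.
have e0 : 0 < e by exact: expR_gt0.
have e1 : 1 <= e by rewrite -expR0 ler_expR.
have -> : ((e + e^-1) / 2) ^+ 2 - 1 = ((e - e^-1) / 2) ^+ 2 by field; lra.
rewrite sqrtr_sqr ger0_norm; last first.
  have : e^-1 <= 1 by rewrite invf_le1.
  by move=> h; apply: divr_ge0 => //; lra.
by rewrite -mulrDl (_ : _ + _ = e * 2) ?mulfK ?expRK//; ring.
Qed.

Lemma cosh_arcosh t : 1 <= t ->
  (expR (arcosh t) + expR (- arcosh t)) / 2 = t.
Proof.
move=> t1; rewrite expRN /arcosh.
have r0 : 0 <= t ^+ 2 - 1 by rewrite subr_ge0 exprn_ege1.
set r := Num.sqrt _; have rE : r ^+ 2 = t ^+ 2 - 1 by exact: sqr_sqrtr.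
have rr : 0 <= r by exact: sqrtr_ge0.
have tr : 0 < t + r by lra.
rewrite lnK ?posrE//.
have -> : (t + r)^-1 = t - r.
  apply: (@mulfI _ (t + r)); first by rewrite gt_eqF.
  rewrite mulfV ?gt_eqF// (_ : _ * _ = t ^+ 2 - r ^+ 2); last by ring.
  by rewrite rE; ring.
by field.
Qed.

(** Cauchy-Schwarz through Lagrange's identity; it puts the argument of [acos] in its domain. *)
Lemma sphere_form_le1 p x : 0 < k -> model_plane k p -> model_plane k x ->
  -1 <= k * model_form k p x <= 1.
Proof.
move=> k0; rewrite /model_plane/= gt_eqF// /model_form gtr0_sg// !mul1r.
move=> [hp _] [hx _]; rewrite -ler_norml -(@ler_pXn2r _ 2)// ?nnegrE// expr1n.
rewrite real_normK ?num_real//.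
set p0 := p 0 0 in hp *; set p1 := p 0 1 in hp *; set p2 := p 0 2 in hp *.
set x0 := x 0 0 in hx *; set x1 := x 0 1 in hx *; set x2 := x 0 2 in hx *.
have -> : 1 = (k * (p0 * p0 + p1 * p1 + p2 * p2)) * (k * (x0 * x0 + x1 * x1 + x2 * x2)).
  by rewrite hp hx mulr1.
rewrite -subr_ge0.
have -> : k * (p0 * p0 + p1 * p1 + p2 * p2) * (k * (x0 * x0 + x1 * x1 + x2 * x2)) -
  (k * (p0 * x0 + p1 * x1 + p2 * x2)) ^+ 2 =
  k ^+ 2 * ((p0 * x1 - p1 * x0) ^+ 2 + (p0 * x2 - p2 * x0) ^+ 2 + (p1 * x2 - p2 * x1) ^+ 2) by ring.
by rewrite mulr_ge0 ?sqr_ge0// !addr_ge0 ?sqr_ge0.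
Qed.

(** The reverse Cauchy-Schwarz inequality: the time coordinates are eliminated by the equation of
    the sheet, and the squared difference is a sum of squares. *)
Lemma hyperboloid_form_ge1 p x : k < 0 -> model_plane k p -> model_plane k x ->
  1 <= k * model_form k p x.
Proof.
move=> k0; rewrite /model_plane/= lt_eqF// /model_form ltr0_sg//.
move=> [hp /(_ k0) +] [hx /(_ k0) +].
set p0 := p 0 0 in hp *; set p1 := p 0 1 in hp *; set p2 := p 0 2 in hp *.
set x0 := x 0 0 in hx *; set x1 := x 0 1 in hx *; set x2 := x 0 2 in hx *.
move=> p00 x00.
pose n := - k; have n0 : 0 < n by rewrite oppr_gt0.
have hp' : n * (p0 * p0) = 1 + n * (p1 * p1 + p2 * p2) by rewrite /n; lra.
have hx' : n * (x0 * x0) = 1 + n * (x1 * x1 + x2 * x2) by rewrite /n; lra.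
set S := p1 * x1 + p2 * x2.
suff : 1 + n * S <= n * (p0 * x0) by rewrite /S /n; lra.
have pos : 0 <= n * (p0 * x0) by rewrite ltW// !mulr_gt0.
case: (leP (1 + n * S) 0) => hS; first exact: le_trans hS pos.
rewrite -(@ler_pXn2r _ 2) ?nnegrE ?(ltW hS)//.
have -> : (n * (p0 * x0)) ^+ 2 = (n * (p0 * p0)) * (n * (x0 * x0)) by ring.
rewrite hp' hx' -subr_ge0 /S.
have -> : (1 + n * (p1 * p1 + p2 * p2)) * (1 + n * (x1 * x1 + x2 * x2)) -
  (1 + n * (p1 * x1 + p2 * x2)) ^+ 2 =
  n * ((p1 - x1) ^+ 2 + (p2 - x2) ^+ 2) + n ^+ 2 * (p1 * x2 - p2 * x1) ^+ 2 by ring.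
by rewrite addr_ge0// mulr_ge0 ?sqr_ge0 ?addr_ge0 ?sqr_ge0// ltW.
Qed.

Lemma model_md_dist p x : model_plane k p -> model_plane k x ->
  model_md p x = md (model_dist k p x).
Proof.
move=> hp hx; rewrite /model_md /model_dist /md.
case: (eqVneq k 0) => [k0|k0].
  rewrite sqr_sqrtr// /model_form k0 sgr0 !mul0r add0r.
  by rewrite addr_ge0// -expr2 sqr_ge0.
have q0 := curv_rad_gt0 k0.
case: (ltP 0 k) => [kp|kn].
  rewrite /curv_rad gtr0_norm// mulrCA mulfV ?mulr1; last by rewrite gt_eqF// sqrtr_gt0.
  by rewrite acosK// in_itv/= sphere_form_le1.
have k0' : k < 0 by rewrite lt_neqAle k0.
rewrite /curv_rad ltr0_norm// mulrCA mulfV ?mulr1; last by rewrite gt_eqF// sqrtr_gt0 oppr_gt0.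
by rewrite cosh_arcosh// hyperboloid_form_ge1.
Qed.

Lemma model_dist_md p x t : 0 <= t -> (0 < k -> q * t <= pi) ->
  model_md p x = md t -> model_dist k p x = t.
Proof.
move=> t0 ht; rewrite /model_md /model_dist /md.
case: (eqVneq k 0) => [k0 /(congr1 (fun z => z * 2))|k0].
  rewrite !divfK// => h.
  rewrite (_ : model_form _ _ _ = t ^+ 2) ?sqrtr_sqr ?ger0_norm// -h /model_form !mxE; ring.
have q0 := curv_rad_gt0 k0.
have key (C : R) : (1 - k * model_form k p x) / k = (1 - C) / k -> k * model_form k p x = C.
  by move/(congr1 (fun z => z * k)); rewrite !divfK// => h; lra.
case: (ltP 0 k) => [kp|kn] /key ->.
  rewrite cosK; last by rewrite in_itv/= mulr_ge0 ?(ltW q0)//= ht.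
  by rewrite /curv_rad gtr0_norm// mulrC mulKf// gt_eqF// sqrtr_gt0.
have k0' : k < 0 by rewrite lt_neqAle k0.
rewrite arcosh_cosh ?mulr_ge0 ?(ltW q0)//.
by rewrite /curv_rad ltr0_norm// mulrC mulKf// gt_eqF// sqrtr_gt0 oppr_gt0.
Qed.

(* The law of cosines; [c] is the side opposite to the angle. *)
Definition cos_angle a b c : R := (md a + cs a * md b - md c) / (sn a * sn b).

Lemma plane_angleE p x y a b c : model_plane k p -> model_plane k x ->
  model_plane k y -> 0 < a -> 0 < b -> subdiam k a -> subdiam k b ->
  model_dist k p x = a -> model_dist k p y = b -> model_dist k x y = c ->
  plane_angle k p x y = acos (cos_angle a b c).
Proof.
move=> hp hx hy a0 b0 ar br px py xy.
rewrite /plane_angle model_dirE// !model_dir_norm// !model_md_dist// px py xy.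
have sqE t : 0 < t -> subdiam k t -> Num.sqrt (2 * md t - k * md t ^+ 2) = sn t.
  move=> t0 tr; rewrite (_ : _ - _ = sn t ^+ 2).
    by rewrite sqrtr_sqr ger0_norm// ltW// sn_gt0.
  by rewrite sn_sq /cs; ring.
rewrite !sqE// /cos_angle /cs; congr (acos (_ / _)); ring.
Qed.

Lemma curv_radE : 0 < k -> q = Num.sqrt k.
Proof. by move=> k0; rewrite /curv_rad gtr0_norm. Qed.

Definition perimeter_lt a b c : Prop := 0 < k -> q * (a + b + c) < 2 * pi.

Lemma md_periodic t : 0 < k -> md (2 * pi / q - t) = md t.
Proof.
move=> k0; have q0 : 0 < q by apply: curv_rad_gt0; rewrite gt_eqF.
rewrite /md gt_eqF// k0 mulrBr [q * (_ / _)]mulrC divfK ?gt_eqF//.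
by rewrite mulr_natl -cosN opprB -(cosD2pi (q * t - pi *+ 2)) subrK.
Qed.

(** The two bounds amount to [md (a - b) <= md c <= md (a + b)]. *)
Lemma cos_angle_range a b c : 0 < a -> 0 < b -> 0 <= c ->
  a <= b + c -> b <= a + c -> c <= a + b -> perimeter_lt a b c ->
  -1 <= cos_angle a b c <= 1.
Proof.
move=> a0 b0 c0 abc bac cab peri.
have half t : t <= (a + b + c) / 2 -> subdiam k t.
  move=> h k0; have q0 : 0 < q by apply: curv_rad_gt0; rewrite gt_eqF.
  have := peri k0; have : q * t <= q * ((a + b + c) / 2) by rewrite ler_pM2l.
  lra.
have sa : 0 < sn a by apply: sn_gt0 => //; apply: half; lra.
have sb : 0 < sn b by apply: sn_gt0 => //; apply: half; lra.
have sab : 0 < sn a * sn b by rewrite mulr_gt0.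
have cr : subdiam k c by apply: half; lra.
rewrite /cos_angle ler_pdivlMr// ler_pdivrMr// mul1r mulN1r; apply/andP; split.
  suff : md c <= md (a + b) by rewrite mdD /cs; lra.
  have [kp|kn] := ltP 0 k; last first.
    by apply: md_le => // k0; move: kn; rewrite leNgt k0.
  have q0 : 0 < q by apply: curv_rad_gt0; rewrite gt_eqF.
  have [h|h] := leP (q * (a + b)) pi; first by apply: md_le.
  (* On the sphere [a + b] may exceed the diameter. Its reflection [2 pi / q - (a + b)] has the same
     [md] and is at least [c] by the perimeter bound. *)
  rewrite -(md_periodic (a + b) kp); apply: md_le => //.
    rewrite lerBrDr ler_pdivlMr// mulrC; have := peri kp.
    by rewrite (_ : c + (a + b) = a + b + c); [exact: ltW|ring].
  by move=> _; rewrite mulrBr mulrC divfK ?gt_eqF//; lra.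
suff : md (a - b) <= md c by rewrite mdB /cs; lra.
have -> : md (a - b) = md `|a - b| by case: (ler0P (a - b)) => _; rewrite ?mdN.
by apply: md_le_subdiam => //; rewrite ler_norml; apply/andP; split; lra.
Qed.

Lemma cs_sn_sq t : cs t ^+ 2 + k * sn t ^+ 2 = 1.
Proof. by rewrite sn_sq /cs; ring. Qed.

(** [p] is the pole, [x] lies on the meridian with last coordinate 0, and [y] on the meridian at the
    angle with cosine [C] and sine [S]. *)
Lemma model_triangle_exists a b c : 0 < a -> 0 < b -> 0 <= c ->
  a <= b + c -> b <= a + c -> c <= a + b -> perimeter_lt a b c ->
  exists p x y,
    [/\ model_plane k p, model_plane k x & model_plane k y] /\
    [/\ model_dist k p x = a, model_dist k p y = b & model_dist k x y = c].
Proof.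
move=> a0 b0 c0 abc bac cab peri.
have half t : t <= (a + b + c) / 2 -> subdiam k t.
  move=> h k0; have q0 : 0 < q by apply: curv_rad_gt0; rewrite gt_eqF.
  have := peri k0; have : q * t <= q * ((a + b + c) / 2) by rewrite ler_pM2l.
  lra.
have ar : subdiam k a by apply: half; lra.
have br : subdiam k b by apply: half; lra.
have cr : subdiam k c by apply: half; lra.
have sa : 0 < sn a by exact: sn_gt0.
have sb : 0 < sn b by exact: sn_gt0.
set C := cos_angle a b c.
have CE : sn a * sn b * C = md a + cs a * md b - md c.
  by rewrite /C /cos_angle; field; rewrite !gt_eqF.
have /andP[C1 C2] : -1 <= C <= 1 by exact: cos_angle_range.
clearbody C.
pose S := Num.sqrt (1 - C ^+ 2).
have SE : S ^+ 2 = 1 - C ^+ 2.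
  rewrite sqr_sqrtr// subr_ge0 -(expr1n _ 2) -[leLHS]real_normK ?num_real//.
  by rewrite ler_pXn2r ?nnegrE// ler_norml C1.
(* The height of the pole; for [k = 0] the model plane is [x_0 = 0]. *)
pose P : R := if k == 0 then 0 else q^-1.
have PE : k != 0 -> Num.sg k * P ^+ 2 * k = 1.
  move=> k0; rewrite /P (negbTE k0) exprVn.
  have q0 := curv_rad_gt0 k0.
  case: (ltgtP 0 k) => k0'; last by rewrite -k0' eqxx in k0.
    by rewrite gtr0_sg// mul1r curv_rad_sq_pos// mulVf.
  by rewrite ltr0_sg// curv_rad_sq_neg// mulN1r invrN opprK mulVf.
pose mk (u v w : R) : 'rV[R]_3 := \row_(j < 3) [:: u; v; w]`_j.
have mk0 u v w : mk u v w 0 0 = u by rewrite mxE.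
have mk1 u v w : mk u v w 0 1 = v by rewrite mxE.
have mk2 u v w : mk u v w 0 2 = w by rewrite mxE.
pose p := mk P 0 0.
pose x := mk (cs a * P) (sn a) 0.
pose y := mk (cs b * P) (sn b * C) (sn b * S).
have mkE := (mk0, mk1, mk2).
have cs_pos t : k < 0 -> 0 < cs t.
  move=> k0; have : k * md t <= 0 by rewrite mulr_le0_ge0 ?md_ge0// ltW.
  by rewrite /cs; lra.
have inplane t u v : u ^+ 2 + v ^+ 2 = sn t ^+ 2 -> model_plane k (mk (cs t * P) u v).
  move=> uv; rewrite /model_plane/= /model_form !mkE.
  case: (eqVneq k 0) => [k0|k0]; first by rewrite /P k0 eqxx mulr0.
  split; last first.
    move=> kn; rewrite mulr_gt0 ?cs_pos// /P (negbTE k0) invr_gt0.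
    exact: curv_rad_gt0.
  have e1 := PE k0; have e2 := cs_sn_sq t; rewrite -uv in e2.
  transitivity (Num.sg k * P ^+ 2 * k * cs t ^+ 2 + k * (u ^+ 2 + v ^+ 2)); first ring.
  by rewrite e1 mul1r.
have hp : model_plane k p.
  by have := @inplane 0 0 0; rewrite sn0 cs0 mul1r; apply; rewrite !expr0n/= addr0.
have hx : model_plane k x by apply: inplane; rewrite expr0n/= addr0.
have hy : model_plane k y.
  by apply: inplane; rewrite !exprMn SE; ring.
have dpt t u v : u ^+ 2 + v ^+ 2 = sn t ^+ 2 ->
    model_md p (mk (cs t * P) u v) = md t.
  move=> uv; rewrite /model_md; case: (eqVneq k 0) => [k0|k0].
    rewrite /model_form !mxE/= !subr0.
    have := sn_sq k t; rewrite -uv /cs k0 sgr0 !mul0r add0r => h.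
    by rewrite -!expr2 h; field.
  rewrite /model_form !mkE !mul0r !addr0.
  rewrite (_ : k * _ = Num.sg k * P ^+ 2 * k * cs t); last by ring.
  by rewrite PE// mul1r /cs; field.
have dxy : model_md x y = md c.
  rewrite /model_md; case: (eqVneq k 0) => [k0|k0].
    rewrite (_ : model_form _ _ _ =
      sn b ^+ 2 * (C ^+ 2 + S ^+ 2) + sn a ^+ 2 - 2 * (sn a * sn b * C)); last first.
      by rewrite /model_form !mxE/= k0 sgr0; ring.
    by rewrite CE SE addrCA subrr addr0 !sn_sq /cs k0; field.
  rewrite /model_form !mkE mul0r addr0.
  rewrite (_ : k * _ = Num.sg k * P ^+ 2 * k * (cs a * cs b) + k * (sn a * sn b * C)); last by ring.
  by rewrite PE// mul1r CE /cs; field.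
exists p, x, y; split => //; split.
- apply: model_dist_md; [exact: ltW|exact: subdiamW|].
  by apply: dpt; rewrite expr0n/= addr0.
- apply: model_dist_md; [exact: ltW|exact: subdiamW|].
  by apply: dpt; rewrite !exprMn SE; ring.
- by apply: model_dist_md => //; exact: subdiamW.
Qed.

End ModelPlaneTrigonometry.

Section ModelAngle.
Context {R : realType} (k : R) {X : metricType R}.
Implicit Types p x y : X.

Lemma perimeter_ltP p x y :
  ((mdist p x + mdist p y + mdist x y)%:E < 2%:E * model_diam k)%E <->
  perimeter_lt k (mdist p x) (mdist p y) (mdist x y).
Proof.
rewrite /model_diam /perimeter_lt; case: ifPn => k0; last first.
  rewrite muleC gt0_mulye ?lte_fin// ltry; split => // _ /(negP k0).
have q0 : 0 < curv_rad k by apply: curv_rad_gt0; rewrite gt_eqF.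
rewrite -EFinM lte_fin -curv_radE// mulrA ltr_pdivlMr// mulrC.
by split => [h _ //|]; apply.
Qed.

Lemma model_angleE p x y : model_angle_defined k p x y ->
  -1 <= cos_angle k (mdist p x) (mdist p y) (mdist x y) <= 1 /\
  model_angle k p x y = acos (cos_angle k (mdist p x) (mdist p y) (mdist x y)).
Proof.
move=> [px py /perimeter_ltP peri].
have a0 : 0 < mdist p x by rewrite mdist_gt0.
have b0 : 0 < mdist p y by rewrite mdist_gt0.
have c0 : 0 <= mdist x y by exact: mdist_ge0.
have t1 : mdist p x <= mdist p y + mdist x y.
  by rewrite (metric_sym x y); exact: metric_triangle.
have t2 : mdist p y <= mdist p x + mdist x y by exact: metric_triangle.
have t3 : mdist x y <= mdist p x + mdist p y.
  by rewrite (metric_sym p x); exact: metric_triangle.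
have half t : t <= (mdist p x + mdist p y + mdist x y) / 2 -> subdiam k t.
  move=> h k0; have q0 : 0 < curv_rad k by apply: curv_rad_gt0; rewrite gt_eqF.
  have := peri k0.
  have : curv_rad k * t <= curv_rad k * ((mdist p x + mdist p y + mdist x y) / 2).
    by rewrite ler_pM2l.
  lra.
split; first exact: cos_angle_range.
rewrite /model_angle; case: xgetP => [t -> [p' [x' [y' [[hp hx hy] [dpx dpy dxy ->]]]]]|].
  by apply: plane_angleE => //; apply: half; lra.
have [p' [x' [y' [[hp hx hy] [dpx dpy dxy]]]]] :=
  model_triangle_exists a0 b0 c0 t1 t2 t3 peri.
move=> /(_ (plane_angle k p' x' y')) []; exists p', x', y'; split => //.
Qed.

End ModelAngle.

(** * The (1+3)-point comparison, local and global *)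

Section QuadrupleComparison.
Context {R : realType} (k : R) {X : metricType R}.
Local Notation sn := (sn k).
Local Notation cs := (cs k).
Local Notation md := (md k).
Local Notation subdiam := (subdiam k).
Implicit Types (p x y u v w z : X) (a b c e q r s t : R).

Lemma acos_le s t : -1 <= s -> s <= t -> t <= 1 -> acos t <= acos s.
Proof.
move=> s1 st t1; rewrite leNgt; apply/negP => h.
have sI : -1 <= s <= 1 by rewrite s1 (le_trans st).
have tI : -1 <= t <= 1 by rewrite t1 (le_trans s1).
have I1 : acos s \in `[0, pi] by rewrite in_itv/= acos_ge0// acos_lepi.
have I2 : acos t \in `[0, pi] by rewrite in_itv/= acos_ge0// acos_lepi.
move: h; rewrite -(ltr_cos I1 I2) !acosK ?in_itv//=.
by rewrite ltNge st.
Qed.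

Lemma acos_le_inv s t : -1 <= s <= 1 -> -1 <= t <= 1 -> acos t <= acos s -> s <= t.
Proof.
move=> sI tI h; rewrite leNgt; apply/negP => ts.
have I1 : acos s \in `[0, pi] by rewrite in_itv/= acos_ge0// acos_lepi.
have I2 : acos t \in `[0, pi] by rewrite in_itv/= acos_ge0// acos_lepi.
move: ts; rewrite -[t]acosK ?in_itv// -[s]acosK ?in_itv// ltr_cos//.
by rewrite ltNge h.
Qed.

Lemma cos_angleC a b c : cos_angle k a b c = cos_angle k b a c.
Proof. by rewrite /cos_angle [sn b * _]mulrC /cs; congr (_ / _); ring. Qed.

Lemma cos_angle_flat a b : sn a != 0 -> sn b != 0 -> cos_angle k a b (a + b) = -1.
Proof. by move=> a0 b0; rewrite /cos_angle mdD /cs; field; rewrite b0. Qed.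

Lemma model_angle_sym p x y : model_angle_defined k p x y -> model_angle_defined k p y x.
Proof. by move=> [? ? h]; split=> //; rewrite (metric_sym y) (addrC (mdist p y)). Qed.

Hypothesis locX : forall x : X, exists2 Omega : set X, nbhs x Omega &
  forall p x1 x2 x3 : X, Omega p -> Omega x1 -> Omega x2 -> Omega x3 ->
    comparison13 k p x1 x2 x3.

(** Shrinking the neighborhood makes every perimeter less than [6 r <= 2 e], so all model angles are
    defined and only the inequality of [comparison13] remains. *)
Lemma local_comparison w : exists2 r : R, 0 < r & subdiam (3 * r) /\
  forall p x1 x2 x3, mdist w p < r -> mdist w x1 < r -> mdist w x2 < r ->
    mdist w x3 < r -> p != x1 -> p != x2 -> p != x3 ->
    [/\ model_angle_defined k p x1 x2, model_angle_defined k p x2 x3,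
        model_angle_defined k p x3 x1 &
        model_angle k p x1 x2 + model_angle k p x2 x3 +
        model_angle k p x3 x1 <= 2 * pi].
Proof.
have [W /nbhs_ballP[r /= r0 hr] hW] := locX w.
have [e e0 he] := exists_subdiam k.
pose m := Num.min r (e / 3).
have m0 : 0 < m by rewrite lt_min r0 divr_gt0.
have [mr me] : m <= r /\ m <= e / 3 by split; rewrite ge_min lexx ?orbT.
exists m => //; split; first by apply: le_subdiam he; lra.
have inW x : mdist w x < m -> W x.
  by move=> wx; apply: hr; rewrite ballEmdist/=; lra.
have far x y : mdist w x < m -> mdist w y < m -> mdist x y < 2 * m.
  by move=> h1 h2; have := metric_triangle x w y; rewrite (metric_sym x w); lra.
have def p x y : mdist w p < m -> mdist w x < m -> mdist w y < m ->
    p != x -> p != y -> model_angle_defined k p x y.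
  move=> wp wx wy px py; split => //; apply/perimeter_ltP => k0.
  have q0 : 0 < curv_rad k by apply: curv_rad_gt0; rewrite gt_eqF.
  have := he k0.
  have : curv_rad k * (mdist p x + mdist p y + mdist x y) <= curv_rad k * (2 * e).
    by rewrite ler_pM2l//; have := far _ _ wp wx; have := far _ _ wp wy;
      have := far _ _ wx wy; lra.
  lra.
move=> p x1 x2 x3 wp w1 w2 w3 p1 p2 p3.
have d1 := def _ _ _ wp w1 w2 p1 p2.
have d2 := def _ _ _ wp w2 w3 p2 p3.
have d3 := def _ _ _ wp w3 w1 p3 p1.
split => //.
by have [//|[]] := hW p x1 x2 x3 (inW _ wp) (inW _ w1) (inW _ w2) (inW _ w3).
Qed.

(** In the quadruple (v; x, y, p) the model angle towards [x] and [y] is pi, so the other two add up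
    to at most pi; clearing denominators in the cosines gives [three_point]. *)
Lemma local_three_point w : exists2 r : R, 0 < r & locally_three_point k w r.
Proof.
have [r r0 [hr H]] := local_comparison w.
exists r => // p x v y wp wx wv wy xvy.
rewrite /three_point.
have [<-|xv] := eqVneq x v; first by rewrite mdistxx sn0 md0 !mul0r !add0r mulr0 !addr0.
have [->|vy] := eqVneq v y; first by rewrite mdistxx sn0 md0 !mul0r !add0r mulr0 !addr0.
have [->|pv] := eqVneq p v.
  by rewrite mdistxx md0 mulr0 add0r (metric_sym v x).
have far z z' : mdist w z < r -> mdist w z' < r -> mdist z z' < 2 * r.
  by move=> h1 h2; have := metric_triangle z w z'; rewrite (metric_sym z w); lra.
have pos z z' : z != z' -> mdist w z < r -> mdist w z' < r -> 0 < sn (mdist z z').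
  move=> zz hz hz'; apply: sn_gt0; first by rewrite mdist_gt0.
  by apply: le_subdiam hr; have := far _ _ hz hz'; lra.
have vx : v != x by rewrite eq_sym.
have vp : v != p by rewrite eq_sym.
have [d1 d2 d3] := H v x y p wv wx wy wp vx vy vp.
have [r1 ->] := model_angleE d1; have [r2 ->] := model_angleE d2.
have [r3 ->] := model_angleE d3.
rewrite -xvy (metric_sym x v) cos_angle_flat ?gt_eqF ?pos// acosN1 => h.
set k2 := cos_angle _ _ _ _ in h r2; set k3 := cos_angle _ _ _ _ in h r3.
have : - k3 <= k2.
  apply: acos_le_inv => //; first by rewrite lerN2 lerNl andbC.
  by rewrite acosN//; lra.
move=> h'.
have svx : 0 < sn (mdist v x) by exact: pos.
have svy : 0 < sn (mdist v y) by exact: pos.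
have svp : 0 < sn (mdist v p) by exact: pos.
have {h'} : 0 <= sn (mdist v x) * sn (mdist v y) * sn (mdist v p) *
    (k2 + k3) by rewrite mulr_ge0 ?mulr_ge0 ?(ltW svx) ?(ltW svy) ?(ltW svp)//; lra.
have -> : sn (mdist v x) * sn (mdist v y) * sn (mdist v p) * (k2 + k3) =
  sn (mdist v x) * (md (mdist v y) + cs (mdist v y) * md (mdist v p) - md (mdist p y)) +
  sn (mdist v y) * (md (mdist v x) + cs (mdist v x) * md (mdist v p) - md (mdist p x)).
  rewrite /k2 /k3 /cos_angle (metric_sym y p) /cs.
  by field; rewrite !gt_eqF.
by rewrite snD (metric_sym p v); clear -k locX; lra.
Qed.

Hypothesis geoX : geodesic_space X.

Lemma half_perimeter p x y t : model_angle_defined k p x y ->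
  t <= (mdist p x + mdist p y + mdist x y) / 2 -> subdiam t.
Proof.
move=> [_ _ /perimeter_ltP peri] h k0.
have q0 : 0 < curv_rad k by apply: curv_rad_gt0; rewrite gt_eqF.
have := peri k0.
have : curv_rad k * t <= curv_rad k * ((mdist p x + mdist p y + mdist x y) / 2).
  by rewrite ler_pM2l.
lra.
Qed.

(** The global chord bound for [x] along [p y], read through the law of cosines: model angles do not
    decrease as an endpoint slides towards [p]. *)
Lemma cos_angle_mono p x y (c : R -> X) t :
  model_angle_defined k p x y -> c 0 = p -> c (mdist p y) = y ->
  is_geo c (mdist p y) -> 0 < t <= mdist p y ->
  model_angle_defined k p x (c t) /\
  cos_angle k (mdist p x) t (mdist x (c t)) <=
  cos_angle k (mdist p x) (mdist p y) (mdist x y).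
Proof.
move=> def c0 c1 gc /andP[t0 tL].
have [px py /perimeter_ltP peri] := def.
have a0 : 0 < mdist p x by rewrite mdist_gt0.
have L0 : 0 < mdist p y by rewrite mdist_gt0.
set a := mdist p x in peri a0 *; set L := mdist p y in peri L0 c1 gc tL *.
set m := mdist x y in peri *.
have half s : s <= (a + L + m) / 2 -> subdiam s by exact: half_perimeter.
have t1 : a <= L + m by rewrite /m (metric_sym x y); exact: metric_triangle.
have t2 : L <= a + m by exact: metric_triangle.
have t3 : m <= a + L by rewrite /a (metric_sym p x); exact: metric_triangle.
have I0 : 0 <= (0 : R) <= L by rewrite lexx ltW.
have IL : 0 <= L <= L by rewrite lexx ltW.
have pc s : 0 <= s <= L -> mdist p (c s) = s.
  by move=> sL; rewrite -c0 gc// sub0r normrN ger0_norm//; case/andP: sL.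
have cy s : 0 <= s <= L -> mdist (c s) y = L - s.
  by move=> sL; rewrite -c1 gc// distrC ger0_norm// subr_ge0; case/andP: sL.
have xc s : 0 <= s <= L -> mdist x (c s) <= a + s /\ mdist x (c s) <= m + (L - s).
  move=> sL; split.
    by have := metric_triangle x p (c s); rewrite pc// (metric_sym x p).
  by have := metric_triangle x y (c s); rewrite (metric_sym y) cy.
have tI : 0 <= t <= L by rewrite tL ltW.
have lr : subdiam L by apply: half; lra.
have sL : 0 < sn L by exact: sn_gt0.
have st : 0 < sn t by apply: sn_gt0 => //; apply: half; lra.
have sa : 0 < sn a by apply: sn_gt0 => //; apply: half; lra.
split.
  split => //; first by rewrite -mdist_gt0 pc.
  apply/perimeter_ltP => k0; apply: le_lt_trans (peri k0).
  have q0 : 0 < curv_rad k by apply: curv_rad_gt0; rewrite gt_eqF.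
  by rewrite ler_pM2l// pc//; have [] := xc t tI; rewrite -/a; lra.
have := @global_chord _ k _ geoX local_three_point x c L L0 lr gc _ t tI.
rewrite c0 c1 (metric_sym x p) -/a -/m => /(_ _) h.
have {}h : jacobi k (md a) (chord_slope k (md a) (md m) L) t <= md (mdist x (c t)).
  apply: h => s /andP[s0 s1]; have sI : 0 <= s <= L by rewrite !ltW.
  by have [] := xc s sI; move=> *; apply: half; lra.
rewrite /cos_angle ler_pdivrMr ?mulr_gt0//.
rewrite (_ : _ / _ * _ = md a + cs a * md t - (md t + cs t * md a + sn t *
  chord_slope k (md a) (md m) L)); last first.
  by rewrite /chord_slope /cs; field; rewrite !gt_eqF.
by move: h; rewrite /jacobi; lra.
Qed.

(** Slide the three points along geodesics to a common small distance [t] from [p]. Each model angle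
    can only grow, and there the local comparison holds. *)
Lemma global_comparison p x1 x2 x3 : comparison13 k p x1 x2 x3.
Proof.
case: (pselect [/\ model_angle_defined k p x1 x2, model_angle_defined k p x2 x3 &
  model_angle_defined k p x3 x1]) => [[d12 d23 d31]|nd]; [left|by right].
have [r r0 [_ H]] := local_comparison p.
have [p1 p2 _] := d12; have [_ p3 _] := d23.
have [c1 [c10 c1l g1]] := exists_geo geoX p x1.
have [c2 [c20 c2l g2]] := exists_geo geoX p x2.
have [c3 [c30 c3l g3]] := exists_geo geoX p x3.
pose t := Num.min (Num.min r (mdist p x1)) (Num.min (mdist p x2) (mdist p x3)) / 2.
have t0 : 0 < t by rewrite divr_gt0// !lt_min r0 !mdist_gt0 p1 p2.
have : 2 * t <= Num.min (Num.min r (mdist p x1)) (Num.min (mdist p x2) (mdist p x3)).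
  by rewrite /t mulrC divfK.
rewrite !le_min => /andP[/andP[tr t1] /andP[t2 t3]].
have pair x y cx cy : model_angle_defined k p x y ->
    cx 0 = p -> cx (mdist p x) = x -> is_geo cx (mdist p x) -> 2 * t <= mdist p x ->
    cy 0 = p -> cy (mdist p y) = y -> is_geo cy (mdist p y) -> 2 * t <= mdist p y ->
    model_angle k p x y <= model_angle k p (cx t) (cy t).
  move=> d cx0 cxl gx tx cy0 cyl gy ty.
  have tyI : 0 < t <= mdist p y by rewrite t0/=; lra.
  have txI : 0 < t <= mdist p x by rewrite t0/=; lra.
  have [d1 h1] := cos_angle_mono d cy0 cyl gy tyI.
  have d1' := model_angle_sym d1.
  have [d2 h2] := cos_angle_mono d1' cx0 cxl gx txI.
  have d2' := model_angle_sym d2.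
  have [r1 ->] := model_angleE d; have [r2 ->] := model_angleE d2'.
  have I0 L : 2 * t <= L -> 0 <= (0 : R) <= L.
    by rewrite lexx => h; move: h t0; clear -k geoX locX; lra.
  have It L : 2 * t <= L -> 0 <= t <= L.
    by move=> h; apply/andP; move: h t0; clear -k geoX locX; split; lra.
  have pcx : mdist p (cx t) = t.
    by rewrite -{1}cx0 gx ?I0 ?It// sub0r normrN gtr0_norm.
  have pcy : mdist p (cy t) = t.
    by rewrite -{1}cy0 gy ?I0 ?It// sub0r normrN gtr0_norm.
  rewrite pcx pcy in r2 *; rewrite pcy in h2.
  apply: acos_le; [by case/andP: r2| |by case/andP: r1].
  rewrite cos_angleC (metric_sym (cx t)); apply: le_trans h2 _.
  by rewrite (metric_sym (cy t)) cos_angleC; apply: le_trans h1 _; rewrite cos_angleC.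
have near x cx : cx 0 = p -> is_geo cx (mdist p x) -> 2 * t <= mdist p x ->
    mdist p (cx t) = t.
  move=> cx0 gx tx; rewrite -{1}cx0 gx ?lexx ?mdist_ge0//.
    by rewrite sub0r normrN gtr0_norm.
  by apply/andP; split; lra.
have n1 := near _ _ c10 g1 t1; have n2 := near _ _ c20 g2 t2.
have n3 := near _ _ c30 g3 t3.
have pp : mdist p p < r by rewrite mdistxx.
have lt x : mdist p x = t -> mdist p x < r by move=> ->; lra.
have ne x : mdist p x = t -> p != x by rewrite -mdist_gt0 => ->.
have [_ _ _] := H _ _ _ _ pp (lt _ n1) (lt _ n2) (lt _ n3) (ne _ n1) (ne _ n2) (ne _ n3).
have := pair _ _ _ _ d12 c10 c1l g1 t1 c20 c2l g2 t2.
have := pair _ _ _ _ d23 c20 c2l g2 t2 c30 c3l g3 t3.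
have := pair _ _ _ _ d31 c30 c3l g3 t3 c10 c1l g1 t1.
lra.
Qed.

End QuadrupleComparison.

(** * The completion *)

Section LipschitzPaths.
Context {R : realType} {Y : metricType R}.
Implicit Types (x y z : Y) (h : R -> Y) (D E s t : R).

(** A path of length at most [D], encoded by a 1-Lipschitz map on the line that rests at its
    endpoints; in this form finite and infinite concatenations need no reparametrization. *)
Definition lipschitz_path x y D : Prop := 0 <= D /\ exists h,
  [/\ forall s t, mdist (h s) (h t) <= `|s - t|,
      forall t, t <= 0 -> h t = x & forall t, D <= t -> h t = y].

Lemma lipschitz_path_rev x y D : lipschitz_path x y D -> lipschitz_path y x D.
Proof.
move=> [D0 [h [hl h0 hD]]]; split => //; exists (fun t => h (D - t)); split.
- move=> s t; apply: le_trans (hl _ _) _.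
  by rewrite (_ : D - s - (D - t) = t - s) 1?distrC//; ring.
- by move=> t t0; apply: hD; lra.
- by move=> t t0; apply: h0; lra.
Qed.

Definition concat_path D h1 h2 (t : R) : Y := if t <= D then h1 t else h2 (t - D).

Lemma concat_lipschitz D h1 h2 : h1 D = h2 0 ->
  (forall s t, mdist (h1 s) (h1 t) <= `|s - t|) ->
  (forall s t, mdist (h2 s) (h2 t) <= `|s - t|) ->
  forall s t, mdist (concat_path D h1 h2 s) (concat_path D h1 h2 t) <= `|s - t|.
Proof.
move=> hE l1 l2.
have mixed s t : s <= D -> D < t -> mdist (h1 s) (h2 (t - D)) <= `|s - t|.
  move=> sD Dt; have := metric_triangle (h1 s) (h1 D) (h2 (t - D)).
  have := l1 s D; rewrite distrC ger0_norm ?subr_ge0//.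
  have := l2 0 (t - D); rewrite hE sub0r normrN gtr0_norm ?subr_gt0//.
  rewrite distrC gtr0_norm ?subr_gt0; first lra.
  exact: le_lt_trans Dt.
move=> s t; rewrite /concat_path; case: (leP s D) => sD; case: (leP t D) => tD.
- exact: l1.
- exact: mixed.
- by rewrite metric_sym distrC; exact: mixed.
- by apply: le_trans (l2 _ _) _; rewrite (_ : s - D - (t - D) = s - t)//; ring.
Qed.

Lemma lipschitz_path_trans x y z D E :
  lipschitz_path x y D -> lipschitz_path y z E -> lipschitz_path x z (D + E).
Proof.
move=> [D0 [h1 [l1 h10 h1D]]] [E0 [h2 [l2 h20 h2E]]].
split; first exact: addr_ge0.
exists (concat_path D h1 h2); split.
- by apply: concat_lipschitz => //; rewrite h1D// h20.
- by move=> t t0; rewrite /concat_path (le_trans t0 D0) h10.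
- move=> t tDE; rewrite /concat_path; case: (leP t D) => tD; last by rewrite h2E//; lra.
  have E00 : E = 0 by lra.
  by rewrite h1D; [rewrite -(h2E 0) ?h20// E00|lra].
Qed.

(* Infinite concatenation: [T n] is the time at which the path reaches [u n]. *)
Lemma lipschitz_path_limit (u : nat -> Y) y (T : nat -> R) D : T 0 = 0 ->
  (forall n, lipschitz_path (u n) (u n.+1) (T n.+1 - T n)) ->
  (forall n, T n + mdist (u n) y <= D) ->
  (forall t, t < D -> exists n, t <= T n) ->
  lipschitz_path (u 0) y D.
Proof.
move=> T0 step close cov.
have D0 : 0 <= D by apply: le_trans (close 0%N); rewrite T0 add0r mdist_ge0.
split => //.
have /choice[e he] : forall n, exists h, [/\ forall s t, mdist (h s) (h t) <= `|s - t|,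
   forall t, t <= 0 -> h t = u n & forall t, T n.+1 - T n <= t -> h t = u n.+1].
  by move=> n; have [_ [h hh]] := step n; exists h.
(* [H n] follows the first [n] pieces and rests at [u n] from time [T n] on; hence the [H n] agree
   on their common past and have a limit before time [D]. *)
pose fix H n : R -> Y := if n is m.+1 then concat_path (T m) (H m) (e m)
  else fun=> u 0.
have Tle n : T n <= T n.+1 by have [+ _] := step n; rewrite subr_ge0.
have Tmono m n : (m <= n)%N -> T m <= T n.
  elim: n => [|n IH]; first by rewrite leqn0 => /eqP ->.
  rewrite leq_eqVlt => /orP[/eqP -> //|/IH h]; exact: le_trans (Tle n).
have Hend n t : T n <= t -> H n t = u n.
  elim: n t => [//|n IH] t tn /=; rewrite /concat_path; have [_ h0 hD] := he n.
  case: (leP t (T n)) => tT; last by rewrite hD//; lra.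
  have tE : t = T n by apply/eqP; rewrite eq_le tT (le_trans (Tle n)).
  by rewrite tE IH// -(hD 0) ?h0//; rewrite tE in tn; lra.
have Hlip n s t : mdist (H n s) (H n t) <= `|s - t|.
  elim: n s t => [|n IH] s t /=; first by rewrite mdistxx.
  have [l h0 _] := he n.
  by apply: concat_lipschitz => //; rewrite Hend// h0.
have Hstep n t : t <= T n -> H n.+1 t = H n t by move=> h /=; rewrite /concat_path h.
have Hle m n t : (m <= n)%N -> t <= T m -> H n t = H m t.
  move=> mn tm; elim: n mn => [|n IH]; first by rewrite leqn0 => /eqP ->.
  rewrite leq_eqVlt ltnS => /orP[/eqP -> //|mn]; rewrite Hstep ?IH//.
  exact: le_trans tm (Tmono _ _ mn).
have /choice[N hN] : forall t, exists n, t < D -> t <= T n.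
  by move=> t; have [/cov[n hn]|h] := ltP t D; [exists n|exists 0%N => //].
pose h t := if t < D then H (N t) t else y.
have hE n t : t < D -> t <= T n -> h t = H n t.
  move=> tD tn; rewrite /h tD; have tN := hN t tD.
  by case/orP: (leq_total n (N t)) => nn; [rewrite (Hle _ _ _ nn)|rewrite -(Hle _ _ _ nn)].
have hy t : D <= t -> h t = y by move=> tD; rewrite /h ltNge tD.
have mixed s t : s < D -> D <= t -> mdist (h s) (h t) <= `|s - t|.
  move=> sD Dt; have [n sn] := cov s sD; rewrite (hE n)// hy//.
  have := metric_triangle (H n s) (H n (T n)) y; rewrite (Hend n (T n))//.
  have := Hlip n s (T n); rewrite (Hend n (T n))// distrC ger0_norm ?subr_ge0//.
  have := close n; rewrite distrC gtr0_norm ?subr_gt0; first lra.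
  exact: lt_le_trans Dt.
exists h; split => //.
- move=> s t; case: (ltP s D) => sD; case: (ltP t D) => tD.
  + have [m sm] := cov s sD; have [n tn] := cov t tD.
    rewrite (hE (maxn m n))// ?(hE (maxn m n))//.
      exact: le_trans (Tmono _ _ (leq_maxr m n)).
    exact: le_trans (Tmono _ _ (leq_maxl m n)).
  + exact: mixed.
  + by rewrite metric_sym distrC; exact: mixed.
  + by rewrite !hy// mdistxx.
- move=> t t0; case: (ltP t D) => tD; first by rewrite (hE 0%N)// T0.
  have DE : D = 0 by lra.
  rewrite hy//; have := close 0%N; rewrite T0 add0r DE => h0.
  by apply/esym/mdist_positivity/eqP; rewrite eq_le h0 mdist_ge0.
Qed.

Lemma polygon_length_lipschitz (a b C : R) h (s : seq R) :
  (forall s t, mdist (h s) (h t) <= C * `|s - t|) -> path <%R a s ->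
  polygon_length a b h s <= C * (last a s - a).
Proof.
move=> hl; rewrite /polygon_length; elim: s a => [|c s IH] a.
  by rewrite big_nil subrr mulr0.
move=> /= /andP[ac cs]; rewrite big_nat_recl//=.
have := IH c cs; have := hl a c; rewrite distrC gtr0_norm ?subr_gt0// => h1 h2.
by apply: le_trans (lerD h1 h2) _; rewrite -mulrDr le_eqVlt; apply/orP; left;
  apply/eqP; congr (_ * _); ring.
Qed.

Lemma lipschitz_path_curve x y D : lipschitz_path x y D ->
  exists2 g, curve_between x y g & (curve_length 0 1 g <= D%:E)%E.
Proof.
move=> [D0 [h [hl h0 hD]]]; pose g (t : R) := h (D * t).
have gl s t : mdist (g s) (g t) <= D * `|s - t|.
  by apply: le_trans (hl _ _) _; rewrite -mulrBr normrM ger0_norm.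
exists g.
  split; [|by rewrite /g mulr0 h0|by rewrite /g mulr1 hD].
  apply: continuous_subspaceT => t; apply/metricType_numDomainType.cvgrPdist_lt => e e0.
  near=> s; apply: le_lt_trans (gl _ _) _.
  apply: le_lt_trans (_ : (D + 1) * `|t - s| < _); first by rewrite ler_wpM2r//; lra.
  rewrite mulrC -ltr_pdivlMr; last lra.
  by near: s; apply: (@cvgr_dist_lt R R^o _ _ _ id t); [exact: cvg_id|rewrite divr_gt0//; lra].
apply: ge_ereal_sup => _ [s [sp /eqP sl] <-].
by rewrite lee_fin; apply: le_trans (polygon_length_lipschitz 1 gl sp) _; rewrite sl subr0 mulr1.
Unshelve. all: by end_near. Qed.

End LipschitzPaths.

(** * Length structure and comparison on the completion *)

Section Completion.
Context {R : realType} (k : R) {X Y : metricType R} (i : X -> Y).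
Hypothesis geoX : geodesic_space X.
Hypothesis iso : forall x y, mdist (i x) (i y) = mdist x y.
Hypothesis dense_i : dense (range i).

Lemma dense_approx (y : Y) (e : R) : 0 < e -> exists x : X, mdist y (i x) < e.
Proof.
move=> e0.
have ne : (ball y e)° !=set0.
  by exists y; exact: nbhsx_ballx.
have [z [/interior_subset + [x _ xz]]] := dense_i ne (@open_interior _ _).
by rewrite ballEmdist -xz => xe; exists x.
Qed.

(** Points [u n] within [e 2^-n / 4] of [y] have consecutive distances below [e 2^-n / 2], the time
    allotted by [T]; the geodesics of [X] between them concatenate to a path that reaches [y] at
    time [e]. *)
Lemma lipschitz_path_to_dense (y : Y) (e : R) : 0 < e ->
  exists2 x : X, mdist y (i x) <= e & lipschitz_path (i x) y e.
Proof.
move=> e0; pose T n : R := e * (1 - (1 / 2) ^+ n).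
have p0 n : 0 < (1 / 2 : R) ^+ n by rewrite exprn_gt0// divr_gt0.
have /choice[u hu] : forall n, exists x : X, mdist y (i x) < e * (1 / 2) ^+ n / 4.
  by move=> n; apply: dense_approx; rewrite divr_gt0// mulr_gt0.
exists (u 0%N).
  by have := hu 0%N; rewrite expr0; lra.
apply: (@lipschitz_path_limit _ _ (i \o u) y T).
- by rewrite /T expr0 subrr mulr0.
- move=> n; set L := T n.+1 - T n.
  have LE : L = e * (1 / 2) ^+ n / 2 by rewrite /L /T exprS; field.
  have [c [c0 c1 gc]] := exists_geo geoX (u n) (u n.+1).
  set d := mdist (u n) (u n.+1) in c1 gc.
  have d0 : 0 <= d by exact: mdist_ge0.
  have dL : d <= L.
    rewrite /d -iso; have := metric_triangle (i (u n)) y (i (u n.+1)).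
    rewrite (metric_sym _ y); have := hu n; have := hu n.+1.
    have := mulr_gt0 e0 (p0 n); rewrite exprS LE; lra.
  split; first exact: le_trans dL.
  exists (fun t => i (c (clamp d t))); split.
  + by move=> s t; rewrite iso gc ?clamp_itv//; exact: clamp_lipschitz.
  + by move=> t t0; rewrite /clamp max_l ?c0// ge_min t0 orbT.
  + by move=> t tL; rewrite /clamp min_l ?max_r ?c1//; exact: le_trans tL.
- move=> n; rewrite metric_sym; have := hu n; have := mulr_gt0 e0 (p0 n); rewrite /T /=; lra.
- move=> t te.
  have : (fun n => T n) @ \oo --> e * (1 - 0).
    apply: cvgM; first exact: cvg_cst.
    apply: cvgB; first exact: cvg_cst.
    by apply: cvg_expr; rewrite ger0_norm; lra.
  rewrite subr0 mulr1 => /cvgrPdist_lt /(_ (e - t)).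
  rewrite subr_gt0 te => /(_ isT) [N _ /(_ N)] /= /(_ (leqnn N)) h.
  by exists N; have := le_lt_trans (ler_norm _) h; lra.
Qed.

Lemma completion_length_space : length_space Y.
Proof.
move=> x y e e0.
have e8 : 0 < e / 8 by rewrite divr_gt0.
have [u xu pu] := lipschitz_path_to_dense x e8.
have [v yv pv] := lipschitz_path_to_dense y e8.
have puv : lipschitz_path (i u) (i v) (mdist u v).
  have [c [c0 c1 gc]] := exists_geo geoX u v.
  have d0 := mdist_ge0 u v; split => //.
  exists (fun t => i (c (clamp (mdist u v) t))); split.
  + by move=> s t; rewrite iso gc ?clamp_itv//; exact: clamp_lipschitz.
  + by move=> t t0; rewrite /clamp max_l ?c0// ge_min t0 orbT.
  + by move=> t tL; rewrite /clamp min_l ?max_r ?c1.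
have [g hg lg] := lipschitz_path_curve
  (lipschitz_path_trans (lipschitz_path_rev pu) (lipschitz_path_trans puv pv)).
exists g => //; apply: le_lt_trans lg _; rewrite lte_fin.
have := metric_triangle (i u) x (i v); have := metric_triangle x y (i v).
by rewrite iso (metric_sym (i u)); lra.
Qed.

Lemma acos_lower_limit (u : nat -> R) (l e : R) :
  (\forall n \near \oo, -1 <= u n <= 1) ->
  -1 <= l <= 1 -> u @ \oo --> l -> 0 < e ->
  \forall n \near \oo, acos l - e < acos (u n).
Proof.
move=> uI lI ul e0.
have [neg|pos] := ltP (acos l - e) 0.
  by apply: filterS uI => n uIn; apply: lt_le_trans neg _; exact: acos_ge0.
have Il : acos l \in `[0, pi] by rewrite in_itv/= acos_ge0// acos_lepi.
have Ie : acos l - e \in `[0, pi].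
  by rewrite in_itv/= pos; have := acos_lepi lI; lra.
have lt1 : l < cos (acos l - e).
  by rewrite -[ltLHS]acosK ?in_itv//= ltr_cos//; lra.
near=> n; rewrite -[ltLHS]cosK// ltNge; apply/negP => h.
have cI : -1 <= cos (acos l - e) <= 1 by rewrite cos_geN1 cos_le1.
have uIn : -1 <= u n <= 1 by near: n.
have := acos_le_inv cI uIn h; rewrite leNgt => /negP; apply.
by near: n; exact: cvgr_lt ul _ lt1.
Unshelve. all: by end_near. Qed.

Lemma cvg_cos_angle (a b c : nat -> R) (a0 b0 c0 : R) :
  sn k a0 * sn k b0 != 0 ->
  a @ \oo --> a0 -> b @ \oo --> b0 -> c @ \oo --> c0 ->
  (fun n => cos_angle k (a n) (b n) (c n)) @ \oo --> cos_angle k a0 b0 c0.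
Proof.
move=> s0 ha hb hc.
have cm (u : nat -> R) l : u @ \oo --> l -> (fun n => md k (u n)) @ \oo --> md k l.
  by move=> ul; apply: continuous_cvg => //; exact: continuous_md.
have csn (u : nat -> R) l : u @ \oo --> l -> (fun n => sn k (u n)) @ \oo --> sn k l.
  by move=> ul; apply: continuous_cvg => //; exact: continuous_sn.
apply: cvgM; last first.
  by apply: cvgV => //; apply: cvgM; exact: csn.
apply: cvgB; last exact: cm.
apply: cvgD; first exact: cm.
apply: cvgM; last exact: cm.
apply: cvgB; first exact: cvg_cst.
by apply: cvgM; [exact: cvg_cst|exact: cm].
Qed.

Lemma cvg_mdist (u v : nat -> X) (x y : Y) :
  (forall n, mdist x (i (u n)) < (2 : R) ^- n) ->
  (forall n, mdist y (i (v n)) < (2 : R) ^- n) ->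
  (fun n => mdist (u n) (v n)) @ \oo --> mdist x y.
Proof.
move=> hu hv; apply/cvgrPdist_lt => e e0.
have : (fun n => (1 / 2 : R) ^+ n) @ \oo --> (0 : R).
  by apply: cvg_expr; rewrite ger0_norm; lra.
move=> /cvgrPdist_lt/(_ (e / 2)); rewrite divr_gt0// => /(_ isT) H.
near=> n.
have : `|0 - (1 / 2 : R) ^+ n| < e / 2 by near: n.
rewrite sub0r normrN ger0_norm ?exprn_ge0 ?divr_ge0// expr_div_n expr1n mul1r => hn.
have h1 := lt_trans (hu n) hn; have h2 := lt_trans (hv n) hn.
apply: le_lt_trans (_ : mdist x (i (u n)) + mdist y (i (v n)) < e); last lra.
rewrite -iso ler_norml.
have := metric_triangle x (i (u n)) y; have := metric_triangle (i (u n)) (i (v n)) y.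
have := metric_triangle (i (u n)) x (i (v n)); have := metric_triangle x y (i (v n)).
by rewrite !(metric_sym _ y) !(metric_sym _ x) => *; apply/andP; split; lra.
Unshelve. all: by end_near. Qed.

(** Being defined is an open condition on the three distances, so it passes to the approximating
    triples; there the angle is a continuous function of the distances. *)
Lemma model_angle_lower_limit (p x y : Y) (p' x' y' : nat -> X) (e : R) :
  model_angle_defined k p x y -> 0 < e ->
  (forall n, mdist p (i (p' n)) < (2 : R) ^- n) ->
  (forall n, mdist x (i (x' n)) < (2 : R) ^- n) ->
  (forall n, mdist y (i (y' n)) < (2 : R) ^- n) ->
  \forall n \near \oo, model_angle_defined k (p' n) (x' n) (y' n) /\
    model_angle k p x y - e < model_angle k (p' n) (x' n) (y' n).
Proof.
move=> def e0 hp hx hy.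
have cpx := cvg_mdist hp hx; have cpy := cvg_mdist hp hy.
have cxy := cvg_mdist hx hy.
have [px py /perimeter_ltP peri] := def.
have [lI ->] := model_angleE def.
set a := mdist p x in cpx peri lI *; set b := mdist p y in cpy peri lI *.
set c := mdist x y in cxy peri lI *.
have a0 : 0 < a by rewrite mdist_gt0.
have b0 : 0 < b by rewrite mdist_gt0.
have t1 : a <= b + c by rewrite /c (metric_sym x y); exact: metric_triangle.
have t2 : b <= a + c by exact: metric_triangle.
have sa : 0 < sn k a by apply: sn_gt0 => //; apply: (half_perimeter def); rewrite -/a -/b -/c; lra.
have sb : 0 < sn k b by apply: sn_gt0 => //; apply: (half_perimeter def); rewrite -/a -/b -/c; lra.
have evP : \forall n \near \oo, perimeter_lt k (mdist (p' n) (x' n))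
    (mdist (p' n) (y' n)) (mdist (x' n) (y' n)).
  case: (ltP 0 k) => k0; last by apply: nearW => n /lt_le_trans/(_ k0); rewrite ltxx.
  have cs : (fun n => curv_rad k * (mdist (p' n) (x' n) + mdist (p' n) (y' n) +
      mdist (x' n) (y' n))) @ \oo --> curv_rad k * (a + b + c).
    by apply: cvgM; [exact: cvg_cst|apply: cvgD => //; exact: cvgD].
  by near=> n => _; near: n; exact: cvgr_lt cs _ (peri k0).
have ev : \forall n \near \oo, model_angle_defined k (p' n) (x' n) (y' n).
  near=> n; split.
  - by rewrite -mdist_gt0; near: n; exact: cvgr_gt cpx _ a0.
  - by rewrite -mdist_gt0; near: n; exact: cvgr_gt cpy _ b0.
  - by apply/perimeter_ltP; near: n.
pose K n := cos_angle k (mdist (p' n) (x' n)) (mdist (p' n) (y' n)) (mdist (x' n) (y' n)).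
have cK : K @ \oo --> cos_angle k a b c.
  by apply: cvg_cos_angle => //; rewrite gt_eqF// mulr_gt0.
have KI : \forall n \near \oo, -1 <= K n <= 1.
  by apply: filterS ev => n /model_angleE[].
have := acos_lower_limit KI lI cK e0.
move=> aK; near=> n.
have dn : model_angle_defined k (p' n) (x' n) (y' n) by near: n.
split => //; have [_ ->] := model_angleE dn.
by rewrite -/(K n); near: n.
Unshelve. all: by end_near. Qed.

Hypothesis compX : forall p x1 x2 x3 : X, comparison13 k p x1 x2 x3.

Lemma completion_comparison (p x1 x2 x3 : Y) : comparison13 k p x1 x2 x3.
Proof.
case: (pselect [/\ model_angle_defined k p x1 x2, model_angle_defined k p x2 x3 &
  model_angle_defined k p x3 x1]) => [[d12 d23 d31]|nd]; [left|by right].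
have approx (y : Y) : exists u : nat -> X, forall n, mdist y (i (u n)) < (2 : R) ^- n.
  have /choice[u hu] : forall n, exists x : X, mdist y (i x) < (2 : R) ^- n.
    by move=> n; apply: dense_approx; rewrite invr_gt0 exprn_gt0.
  by exists u.
have [p' hp] := approx p; have [y1 h1] := approx x1.
have [y2 h2] := approx x2; have [y3 h3] := approx x3.
rewrite leNgt; apply/negP => gt2pi.
(* A third of the excess: losing less than [e] at each angle leaves a sum above [2 pi] for a
   quadruple of [X]. *)
pose e := (model_angle k p x1 x2 + model_angle k p x2 x3 + model_angle k p x3 x1 - 2 * pi) / 3.
have e0 : 0 < e by rewrite divr_gt0// subr_gt0.
have [n [[e1 l1] [[e2 l2] [e3 l3]]]] := filter_ex (filterI
  (model_angle_lower_limit d12 e0 hp h1 h2) (filterI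
  (model_angle_lower_limit d23 e0 hp h2 h3)
  (model_angle_lower_limit d31 e0 hp h3 h1))).
have [h|[]] := compX (p' n) (y1 n) (y2 n) (y3 n); last by split.
by rewrite /e in l1 l2 l3; lra.
Qed.

End Completion.

Theorem mainTheorem1 (R : realType) (k : R) (X : metricType R)
    (geoX : geodesic_space X)
    (locX : forall x : X, exists2 Omega : set X, nbhs x Omega &
       forall p x1 x2 x3 : X, Omega p -> Omega x1 -> Omega x2 -> Omega x3 ->
         comparison13 k p x1 x2 x3)
    (Y : metricType R) (i : X -> Y) (complY : is_completion i) :
  alexandrov_space k Y.
Proof.
have [iso dense_i complete] := complY; split => //.
  exact: completion_length_space geoX iso dense_i.
apply: (completion_comparison iso dense_i).
exact: global_comparison locX geoX.
Qed.
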